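(* Any minimal space-like surface $\mathcal M$ of general type in $\mathbb R^4_1$, parameterized by canonical coordinates $(u,v)$ of the first type, $t=u+\mathrm i v$, has the following Weierstrass representation of $\Phi=\mathrm x_u-\mathrm i\,\mathrm x_v=(\phi_1,\phi_2,\phi_3,\phi_4)$: $$\phi_1=\frac{\mathrm i}{2}\,\frac{g_1g_2+1}{\sqrt{g_1'g_2'}},\quad \phi_2=\frac12\,\frac{g_1g_2-1}{\sqrt{g_1'g_2'}},\quad \phi_3=\frac12\,\frac{g_1+g_2}{\sqrt{g_1'g_2'}},\quad \phi_4=\frac12\,\frac{g_1-g_2}{\sqrt{g_1'g_2'}},$$ where $(g_1,g_2)$ is a pair of holomorphic functions of $t$ satisfying, at every point, the conditions $$g_1'g_2'\neq0,\qquad g_1\bar g_2\neq-1.$$ Conversely, if $(g_1,g_2)$ is a pair of holomorphic functions on a domain of $\mathbb C$ satisfying $g_1'g_2'\neq0$ and $g_1\bar g_2\neq-1$ at every point, then the function $\Phi=(\phi_1,\phi_2,\phi_3,\phi_4)$ with $$\phi_1=\frac{\mathrm i}{2}\,\frac{g_1g_2+1}{\sqrt{g_1'g_2'}},\quad \phi_2=\frac12\,\frac{g_1g_2-1}{\sqrt{g_1'g_2'}},\quad \phi_3=\frac12\,\frac{g_1+g_2}{\sqrt{g_1'g_2'}},\quad \phi_4=\frac12\,\frac{g_1-g_2}{\sqrt{g_1'g_2'}}$$ generates a minimal space-like surface of general type, parameterized by canonical coordinates of the first type.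
   Context: $\mathbb R^4_1$ is $\mathbb R^4$ with the indefinite product $a\cdot b=a_1b_1+a_2b_2+a_3b_3-a_4b_4$, extended bilinearly to $\mathbb C^4$; $a^2=a\cdot a$. A surface $\mathcal M$ given by an immersion $\mathrm x$ into $\mathbb R^4_1$ is space-like if the induced metric on each tangent space $T_p(\mathcal M)$ is positive definite; $N_p(\mathcal M)$ is the normal space (signature $(1,1)$). The second fundamental form is $\sigma(X,Y)=(\nabla_XY)^\bot$, where $\nabla$ is the flat connection and $\bot$ is the projection to the normal space. The surface is minimal if $H=\frac12\operatorname{trace}\sigma=0$. A point $p$ is degenerate if $\{\sigma(X,Y):X,Y\in T_p(\mathcal M)\}$ is contained in one of the two light-like one-dimensional subspaces of $N_p(\mathcal M)$. A minimal space-like surface is of general type if it has no degenerate points. Coordinates $(u,v)$ are isothermal if $E=\mathrm x_u^2=\mathrm x_v^2$ and $\mathrm x_u\cdot\mathrm x_v=0$. With $t=u+\mathrm i v$ put $\Phi(t)=\mathrm x_u-\mathrm i\,\mathrm x_v$; for a minimal surface in isothermal coordinates $\Phi$ is holomorphic. Isothermal coordinates are canonical of the first type if $\sigma(X_1,X_1)\perp\sigma(X_1,X_2)$ and $E^2(\sigma(X_1,X_1)^2-\sigma(X_1,X_2)^2)=1$, where $X_1=\mathrm x_u/\sqrt E$, $X_2=\mathrm x_v/\sqrt E$; equivalently $\Phi'^2=1$. $\sqrt{g_1'g_2'}$ denotes a holomorphic branch of the square root (chosen locally). A holomorphic $\mathbb C^4$-valued function $\Phi$ ''generates'' a surface in the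 sense that (locally) $\mathrm x=\operatorname{Re}\Psi$, where $\Psi'=\Phi$; then $\mathrm x_u-\mathrm i\,\mathrm x_v=\Phi$ and $\mathrm x$ is determined up to a translation.
   Formalization: In the direct half the representation with holomorphic g1, g2 is claimed where φ2+iφ1≠0 (elsewhere it is impossible, e.g. Enneper's surface at t=0); the other points are shown isolated, and near each the representation holds after a rotation by π in the x1x3-plane. *)

(* Defs.v *)
(* Stdlib reals with Coquelicot.  A point (u, v) : C = R * R of a parameter
   domain is identified with t = u + i v. *)
From Stdlib Require Import Reals.
From Coquelicot Require Import Coquelicot.
Open Scope R_scope.

(** * Domains and holomorphic functions *)

Definition complex_domain (D : C -> Prop) : Prop :=
  open D /\ (exists t, D t) /\
  (forall A B : C -> Prop, open A -> open B ->
     (forall t, D t -> A t \/ B t) ->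
     (exists t, D t /\ A t) -> (exists t, D t /\ B t) ->
     exists t, D t /\ A t /\ B t).

Definition subdomain (U D : C -> Prop) : Prop := forall t, U t -> D t.

(* For [f : C -> C], [ex_derive f t] is complex differentiability at [t];
   only used with [D] open. *)
Definition holomorphic (D : C -> Prop) (f : C -> C) : Prop :=
  forall t, D t -> ex_derive (K := C_AbsRing) (V := C_NormedModule) f t.

Definition sqrt_branch (D : C -> Prop) (h s : C -> C) : Prop :=
  holomorphic D s /\ forall t, D t -> (s t * s t = h t)%C.

(** * The spaces R^4_1 and C^4 *)

Inductive axis : Set := e1 | e2 | e3 | e4.

Definition vec (K : Type) : Type := axis -> K.

Definition dot (a b : vec R) : R :=
  a e1 * b e1 + a e2 * b e2 + a e3 * b e3 - a e4 * b e4.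

(* Rotation through the angle pi in the plane of the axes [e1], [e3]: a proper
   linear isometry of R^4_1. *)
Definition half_turn (a : vec R) : vec R :=
  fun i => match i with
           | e1 => - a e1 | e2 => a e2 | e3 => - a e3 | e4 => a e4
           end.

(** * Calculus in the parameter plane *)

Definition pd_u (f : C -> R) (t : C) : R := Derive (fun r => f (r, snd t)) (fst t).
Definition pd_v (f : C -> R) (t : C) : R := Derive (fun r => f (fst t, r)) (snd t).

Fixpoint Ck (n : nat) (D : C -> Prop) (f : C -> R) : Prop :=
  (forall t, D t -> continuous f t) /\
  match n with
  | O => True
  | S m =>
      (forall t, D t -> ex_derive (fun r => f (r, snd t)) (fst t) /\
                        ex_derive (fun r => f (fst t, r)) (snd t)) /\
      Ck m D (pd_u f) /\ Ck m D (pd_v f)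
  end.

Definition smooth (D : C -> Prop) (x : C -> vec R) : Prop :=
  forall (i : axis) (n : nat), Ck n D (fun t => x t i).

Definition Du (x : C -> vec R) : C -> vec R := fun t i => pd_u (fun z => x z i) t.
Definition Dv (x : C -> vec R) : C -> vec R := fun t i => pd_v (fun z => x z i) t.

(** * Geometry of a surface x *)

(* A tangent vector at [t] is given by its coordinates [X] in the basis
   x_u, x_v; this is the corresponding vector of R^4_1. *)
Definition tangent (x : C -> vec R) (t : C) (X : R * R) : vec R :=
  fun i => fst X * Du x t i + snd X * Dv x t i.

Definition gE (x : C -> vec R) (t : C) : R := dot (Du x t) (Du x t).
Definition gF (x : C -> vec R) (t : C) : R := dot (Du x t) (Dv x t).
Definition gG (x : C -> vec R) (t : C) : R := dot (Dv x t) (Dv x t).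
Definition gdet (x : C -> vec R) (t : C) : R :=
  gE x t * gG x t - gF x t * gF x t.

Definition normal (x : C -> vec R) (t : C) (n : vec R) : Prop :=
  dot n (Du x t) = 0 /\ dot n (Dv x t) = 0.

(* Projection along the tangent plane onto the normal space; the coefficients
   of the tangential part come from inverting the Gram matrix of x_u, x_v. *)
Definition normal_part (x : C -> vec R) (t : C) (w : vec R) : vec R :=
  let p := dot w (Du x t) in
  let q := dot w (Dv x t) in
  fun i => w i - tangent x t ((gG x t * p - gF x t * q) / gdet x t,
                              (gE x t * q - gF x t * p) / gdet x t) i.

(* Flat derivative along [X] of the tangent field with constant coordinates [Y]. *)
Definition nabla (x : C -> vec R) (t : C) (X Y : R * R) : vec R :=
  let Yfield := fun z => tangent x z Y in
  fun i => fst X * Du Yfield t i + snd X * Dv Yfield t i.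

(* sigma(X,Y) does not depend on the field extending Y, so the
   constant-coordinate extension is used. *)
Definition sigma (x : C -> vec R) (t : C) (X Y : R * R) : vec R :=
  normal_part x t (nabla x t X Y).

(* Half the trace of sigma with respect to the induced metric, in the basis
   x_u, x_v. *)
Definition mean_curvature (x : C -> vec R) (t : C) : vec R :=
  fun i => / 2 * ((gG x t * sigma x t (1, 0) (1, 0) i
                   - 2 * gF x t * sigma x t (1, 0) (0, 1) i
                   + gE x t * sigma x t (0, 1) (0, 1) i) / gdet x t).

Definition spacelike_surface (D : C -> Prop) (x : C -> vec R) : Prop :=
  smooth D x /\
  forall t, D t -> forall X : R * R, X <> (0, 0) ->
    0 < dot (tangent x t X) (tangent x t X).

Definition minimal_surface (D : C -> Prop) (x : C -> vec R) : Prop :=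
  forall t, D t -> forall i, mean_curvature x t i = 0.

Definition degenerate_point (x : C -> vec R) (t : C) : Prop :=
  exists n : vec R,
    normal x t n /\ (exists i, n i <> 0) /\ dot n n = 0 /\
    forall X Y : R * R, exists c : R, forall i, sigma x t X Y i = c * n i.

Definition general_type (D : C -> Prop) (x : C -> vec R) : Prop :=
  forall t, D t -> ~ degenerate_point x t.

Definition isothermal (D : C -> Prop) (x : C -> vec R) : Prop :=
  forall t, D t -> gE x t = gG x t /\ gF x t = 0.

Definition canonical_first_type (D : C -> Prop) (x : C -> vec R) : Prop :=
  isothermal D x /\
  forall t, D t ->
    let X1 := (/ sqrt (gE x t), 0) in
    let X2 := (0, / sqrt (gE x t)) in
    let s11 := sigma x t X1 X1 in
    let s12 := sigma x t X1 X2 in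
    dot s11 s12 = 0 /\ gE x t ^ 2 * (dot s11 s11 - dot s12 s12) = 1.

Definition minimal_spacelike_general_canonical
    (D : C -> Prop) (x : C -> vec R) : Prop :=
  spacelike_surface D x /\ minimal_surface D x /\ general_type D x /\
  canonical_first_type D x.

(** * Weierstrass data *)

Definition Phi (x : C -> vec R) (t : C) : vec C :=
  fun i => (RtoC (Du x t i) - Ci * RtoC (Dv x t i))%C.

Definition weierstrass_pair (D : C -> Prop) (g1 g2 : C -> C) : Prop :=
  holomorphic D g1 /\ holomorphic D g2 /\
  forall t, D t ->
    (C_derive g1 t * C_derive g2 t)%C <> RtoC 0 /\
    (g1 t * Cconj (g2 t))%C <> RtoC (-1).

(* [s] stands for the chosen branch of the square root of g1' g2'. *)
Definition weierstrass_Phi (g1 g2 s : C -> C) (t : C) : vec C :=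
  fun i => match i with
           | e1 => (Ci / 2 * ((g1 t * g2 t + 1) / s t))%C
           | e2 => (1 / 2 * ((g1 t * g2 t - 1) / s t))%C
           | e3 => (1 / 2 * ((g1 t + g2 t) / s t))%C
           | e4 => (1 / 2 * ((g1 t - g2 t) / s t))%C
           end.

Definition g_sqrt_branch (D : C -> Prop) (g1 g2 s : C -> C) : Prop :=
  sqrt_branch D (fun t => (C_derive g1 t * C_derive g2 t)%C) s.

Definition has_weierstrass_representation
    (D : C -> Prop) (x : C -> vec R) : Prop :=
  exists g1 g2 s : C -> C,
    weierstrass_pair D g1 g2 /\ g_sqrt_branch D g1 g2 s /\
    forall t, D t -> forall i, Phi x t i = weierstrass_Phi g1 g2 s t i.

(* Finite values of g1, g2 give phi_2 + i phi_1 = - 1 / sqrt (g1' g2') <> 0, so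
   the representation by holomorphic g1, g2 can only hold on this part of [D];
   at the other points g1 or g2 has a pole.  For instance g1 = g2 = 1/t,
   sqrt (g1' g2') = 1/t^2 gives
   Phi = (i (1 + t^2) / 2, (1 - t^2) / 2, t, 0), the Enneper surface, which is
   regular of general type in canonical coordinates also at t = 0. *)
Definition finite_part (D : C -> Prop) (x : C -> vec R) (t : C) : Prop :=
  D t /\ (Phi x t e2 + Ci * Phi x t e1)%C <> RtoC 0.

Definition holo_primitive (D : C -> Prop) (Psi : C -> vec C) (phi : C -> vec C) : Prop :=
  forall t, D t -> forall i,
    is_derive (K := C_AbsRing) (V := C_NormedModule)
      (fun z => Psi z i) t (phi t i).

Definition real_part (Psi : C -> vec C) : C -> vec R := fun t i => Re (Psi t i).

(* Main.v *)
Require Import Defs.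
From Stdlib Require Import Reals Lra Psatz Classical FunctionalExtensionality.
From Coquelicot Require Import Coquelicot.
Open Scope R_scope.

(** A minimal space-like surface in isothermal parameters is the real part of a primitive of a
    holomorphic null curve Phi in C^4.  Indeed the Laplacian of x is normal, so that minimality says
    that the coordinates of x are harmonic ([mean_curvature_isothermal]), which together with the
    symmetry of second derivatives are the Cauchy-Riemann equations for Phi = x_u - i x_v;
    isothermality is Phi . Phi = 0, and the hermitian square of Phi is E + G, so it is positive.
    Differentiating the isothermal relations shows that the tangential parts of x_uu and x_uv are
    orthogonal and of equal length, hence the canonical condition is Phi' . Phi' = 1
    ([canonical_isothermal]).  Both directions pass through such curves ([surface_canonical_curve],
    [curve_surface]); absence of degenerate points follows from the canonical condition.

    In the coordinates a = phi_2 + i phi_1, b = phi_2 - i phi_1, c = phi_3 + phi_4, d = phi_3 - phi_4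
    the two equations read a b + c d = 0 and a' b' + c' d' = 1.  The Weierstrass formulas are the
    parametrization (a, b, c, d) = (-1, g1 g2, g1, g2) / s of the quadric a b + c d = 0 where a is not
    zero; it turns a' b' + c' d' into g1' g2' / s^2, so that s is a root of g1' g2', and the hermitian
    square into |1 + g1 (conj g2)|^2 / (2 |s|^2), whose positivity is the condition on g1 and g2
    ([canonical_curve_weierstrass], [weierstrass_canonical_curve]).  At a zero of a, b is not zero, and
    each of c and d is either non-zero or has a simple zero; as a b = - c d, the zeros of a are isolated,
    and a half turn, which exchanges a and b, moves them into the domain of the formulas.

    Complex differentiability alone has to provide primitives and derivatives of all orders.  A form
    A dx + B dy whose coefficients are differentiable and satisfy A_y = B_x has a potential on a
    square, by bisection ([goursat], [potential]).  So a holomorphic f has a primitive F, whose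
    derivative f is continuous.  For such F the mean of F (z + l e^(i t)) e^(- i t) over t is l f (z)
    ([mean_value]), and f can be differentiated under the integral sign: f' is continuous.  The same
    step with f in place of F shows that f' is holomorphic ([holomorphic_derive]). *)

(** * Complex derivatives in real terms *)

(** [p + i q] is complex differentiable at [x + i y] with derivative [a + i b]: the Cauchy-Riemann
    equations are built into the real differentials. *)
Definition CR_differentiable (p q : R -> R -> R) (x y a b : R) : Prop :=
  differentiable_pt_lim p x y a (- b) /\ differentiable_pt_lim q x y b a.

Lemma locally_C_2d (z : C) (P : C -> Prop) :
  locally (T := AbsRing_UniformSpace C_AbsRing) z P <->
  locally_2d (fun u v => P (u, v)) (fst z) (snd z).
Proof.
  rewrite locally_2d_locally. destruct z as [z1 z2]; simpl.
  rewrite <- (locally_C (z1, z2) P).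
  split; intros [d Hd]; exists d; intros [u v] Huv; apply (Hd (u, v) Huv).
Qed.

(** Passage between the complex and the real notion of derivative; only the norms differ, the
    modulus on one side and the maximum of the coordinates on the other. *)
Lemma is_derive_C_iff (f : C -> C) (z l : C) :
  is_derive (K := C_AbsRing) (V := C_NormedModule) f z l <->
  CR_differentiable (fun u v => fst (f (u, v))) (fun u v => snd (f (u, v)))
    (fst z) (snd z) (fst l) (snd l).
Proof.
  split.
  - intros [_ H].
    specialize (H z (fun P h => h)).
    assert (K : forall eps : posreal, locally_2d (fun u v =>
       Cmod (f (u, v) - f z - ((u, v) - z) * l) <=
       eps * Rmax (Rabs (u - fst z)) (Rabs (v - snd z))) (fst z) (snd z)).
    { intros eps.
      assert (He : 0 < eps / sqrt 2).
      { apply Rdiv_lt_0_compat; [apply cond_pos|apply Rlt_sqrt2_0]. }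
      specialize (H (mkposreal _ He)). apply locally_C_2d in H.
      revert H. apply locally_2d_impl, locally_2d_forall. intros u v H.
      eapply Rle_trans; [exact H|]. simpl.
      eapply Rle_trans; [apply Rmult_le_compat_l; [lra|apply Cmod_2Rmax]|].
      simpl. right. unfold Rminus, Rdiv. rewrite Rmult_assoc, <- (Rmult_assoc (/ _)).
      rewrite Rinv_l; [rewrite Rmult_1_l; reflexivity|]. pose proof Rlt_sqrt2_0; lra. }
    destruct z as [z1 z2], l as [l1 l2].
    split; intros eps; generalize (K eps); apply locally_2d_impl, locally_2d_forall;
    intros u v Huv; (eapply Rle_trans; [|exact Huv]);
    (eapply Rle_trans; [|apply Rmax_Cmod]); simpl.
    + eapply Rle_trans; [|apply Rmax_l]. apply Req_le. f_equal. ring.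
    + eapply Rle_trans; [|apply Rmax_r]. apply Req_le. f_equal. ring.
  - intros [H1 H2]. split.
    { apply (is_linear_scal_l (K := C_AbsRing) (V := C_NormedModule) l). }
    intros z' Hz'.
    assert (z = z') as <-.
    { apply (is_filter_lim_locally_unique (K := C_AbsRing) (V := AbsRing_NormedModule C_AbsRing)).
      exact Hz'. }
    clear Hz'. intros eps. apply locally_C_2d.
    assert (He : 0 < eps / sqrt 2).
    { apply Rdiv_lt_0_compat; [apply cond_pos|apply Rlt_sqrt2_0]. }
    specialize (H1 (mkposreal _ He)). specialize (H2 (mkposreal _ He)).
    generalize (locally_2d_and _ _ _ _ H1 H2).
    apply locally_2d_impl, locally_2d_forall. intros u v [K1 K2].
    destruct z as [z1 z2], l as [l1 l2].
    eapply Rle_trans; [apply Cmod_2Rmax|].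
    apply Rle_trans with (sqrt 2 * (eps / sqrt 2 * Rmax (Rabs (u - z1)) (Rabs (v - z2)))).
    + apply Rmult_le_compat_l; [pose proof Rlt_sqrt2_0; lra|].
      apply Rmax_lub; simpl in *.
      * eapply Rle_trans; [|exact K1]. apply Req_le. f_equal.
        match goal with |- ?x = ?y => change x with
          (fst (f (u, v)) + - fst (f (z1, z2)) + - ((u + - z1) * l1 - (v + - z2) * l2)) end. ring.
      * eapply Rle_trans; [|exact K2]. apply Req_le. f_equal.
        match goal with |- ?x = ?y => change x with
          (snd (f (u, v)) + - snd (f (z1, z2)) + - ((u + - z1) * l2 + (v + - z2) * l1)) end. ring.
    + replace (sqrt 2 * (eps / sqrt 2 * Rmax (Rabs (u - z1)) (Rabs (v - z2)))) with
        (eps * Rmax (Rabs (u - z1)) (Rabs (v - z2))) by (field; pose proof Rlt_sqrt2_0; lra).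
      apply Rmult_le_compat_l; [left; apply cond_pos|].
      eapply Rle_trans; [|apply Rmax_Cmod]. apply Rle_refl.
Qed.

(** * Goursat's lemma and potentials *)

(** Closedness of the form [A dx + B dy] at a point: [k] is the common value of [A_y] and [B_x]. *)
Definition curl_free_at (A B : R -> R -> R) (x y : R) : Prop :=
  exists k Ax By, differentiable_pt_lim A x y Ax k /\ differentiable_pt_lim B x y k By.

Lemma continuity_2d_slice_l (f : R -> R -> R) (x y : R) :
  continuity_2d_pt f x y -> continuous (fun s => f s y) x.
Proof.
  intros H. apply continuity_2d_pt_filterlim in H.
  apply (continuous_comp_2 (fun s => s) (fun _ => y) f).
  - apply continuous_id.
  - apply continuous_const.
  - exact H.
Qed.

Lemma continuity_2d_slice_r (f : R -> R -> R) (x y : R) :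
  continuity_2d_pt f x y -> continuous (fun s => f x s) y.
Proof.
  intros H. apply continuity_2d_pt_filterlim in H.
  apply (continuous_comp_2 (fun _ => x) (fun s => s) f).
  - apply continuous_const.
  - apply continuous_id.
  - exact H.
Qed.

Lemma differentiable_continuity (f : R -> R -> R) (x y lx ly : R) :
  differentiable_pt_lim f x y lx ly -> continuity_2d_pt f x y.
Proof. intros H. apply differentiable_continuity_pt. exists lx, ly. exact H. Qed.

Lemma curl_free_continuous (A B : R -> R -> R) (x y : R) :
  curl_free_at A B x y -> continuity_2d_pt A x y /\ continuity_2d_pt B x y.
Proof.
  intros (k & Ax & By & HA & HB).
  split; eapply differentiable_continuity; eassumption.
Qed.

(** Integral of [A dx + B dy] around the boundary of [[a, a'] x [b, b']], with opposite sides paired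
    so that the values to be compared lie under one integral. *)
Definition loop (A B : R -> R -> R) (a a' b b' : R) : R :=
  RInt (fun s => A s b - A s b') a a' + RInt (fun t => B a' t - B a t) b b'.

Lemma RInt_sub (f g : R -> R) (a b : R) :
  ex_RInt f a b -> ex_RInt g a b ->
  RInt (fun s => f s - g s) a b = RInt f a b - RInt g a b.
Proof. exact (RInt_minus (V := R_CompleteNormedModule) f g a b). Qed.

Lemma RInt_split (f : R -> R) (a b c : R) :
  ex_RInt f a b -> ex_RInt f b c -> RInt f a c = RInt f a b + RInt f b c.
Proof. intros Hf Hg. symmetry. exact (RInt_Chasles (V := R_CompleteNormedModule) f a b c Hf Hg). Qed.

Section Rectangle.
Variables (A B : R -> R -> R) (a a' b b' : R).
Hypothesis contA : forall x y, a <= x <= a' -> b <= y <= b' -> continuity_2d_pt A x y.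
Hypothesis contB : forall x y, a <= x <= a' -> b <= y <= b' -> continuity_2d_pt B x y.

Lemma ex_RInt_horizontal x x' y :
  a <= x <= a' -> a <= x' <= a' -> b <= y <= b' -> ex_RInt (fun s => A s y) x x'.
Proof.
  intros Hx Hx' Hy. apply (ex_RInt_continuous (V := R_CompleteNormedModule)). intros z Hz.
  apply continuity_2d_slice_l, contA; [|exact Hy].
  revert Hz. unfold Rmin, Rmax. destruct (Rle_dec x x'); lra.
Qed.

Lemma ex_RInt_vertical y y' x :
  b <= y <= b' -> b <= y' <= b' -> a <= x <= a' -> ex_RInt (fun t => B x t) y y'.
Proof.
  intros Hx Hx' Hy. apply (ex_RInt_continuous (V := R_CompleteNormedModule)). intros z Hz.
  apply continuity_2d_slice_r, contB; [exact Hy|].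
  revert Hz. unfold Rmin, Rmax. destruct (Rle_dec y y'); lra.
Qed.

Lemma loop_sides x x' y y' :
  a <= x <= a' -> a <= x' <= a' -> b <= y <= b' -> b <= y' <= b' ->
  loop A B x x' y y' =
  RInt (fun s => A s y) x x' - RInt (fun s => A s y') x x' +
  RInt (fun t => B x' t) y y' - RInt (fun t => B x t) y y'.
Proof.
  intros Hx Hx' Hy Hy'. unfold loop.
  rewrite (RInt_sub (fun s => A s y) (fun s => A s y') x x');
    [|apply ex_RInt_horizontal; assumption|apply ex_RInt_horizontal; assumption].
  rewrite (RInt_sub (fun t => B x' t) (fun t => B x t) y y');
    [|apply ex_RInt_vertical; assumption|apply ex_RInt_vertical; assumption].
  ring.
Qed.

Lemma loop_quarters m n :
  a <= m <= a' -> b <= n <= b' ->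
  loop A B a a' b b' =
  loop A B a m b n + loop A B m a' b n + loop A B a m n b' + loop A B m a' n b'.
Proof.
  intros Hm Hn. rewrite !loop_sides by lra.
  assert (HA : forall y, b <= y <= b' ->
    RInt (fun s => A s y) a a' = RInt (fun s => A s y) a m + RInt (fun s => A s y) m a').
  { intros y Hy. apply RInt_split; apply ex_RInt_horizontal; lra. }
  assert (HB : forall x, a <= x <= a' ->
    RInt (fun t => B x t) b b' = RInt (fun t => B x t) b n + RInt (fun t => B x t) n b').
  { intros x Hx. apply RInt_split; apply ex_RInt_vertical; lra. }
  rewrite (HA b), (HA b'), (HB a), (HB a') by lra.
  ring.
Qed.

End Rectangle.

Lemma RInt_near_const (f : R -> R) (x x' c M : R) :
  x <= x' -> ex_RInt f x x' -> (forall s, x <= s <= x' -> Rabs (f s - c) <= M) ->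
  Rabs (RInt f x x' - c * (x' - x)) <= (x' - x) * M.
Proof.
  intros Hx Hf HM.
  replace (RInt f x x' - c * (x' - x)) with (RInt (fun s => f s - c) x x').
  - apply abs_RInt_le_const; auto. apply @ex_RInt_minus; auto. apply ex_RInt_const.
  - rewrite (RInt_sub f (fun _ => c)); auto.
    + rewrite RInt_const. unfold scal; simpl. unfold mult; simpl. ring.
    + apply ex_RInt_const.
Qed.

(** Replacing [A] and [B] by their first order expansions at [(u, v)] changes the loop integral by at
    most the stated amount, and the loop integral of the expansions is zero because [A] and [B] have
    the same cross derivative [k]. *)
Lemma loop_small (A B : R -> R -> R) (u v : R) (eps : posreal) :
  curl_free_at A B u v ->
  exists delta : posreal, forall x x' y y',
    x <= u <= x' -> y <= v <= y' -> x' - x < delta -> y' - y < delta ->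
    (forall s t, x <= s <= x' -> y <= t <= y' ->
       continuity_2d_pt A s t /\ continuity_2d_pt B s t) ->
    Rabs (loop A B x x' y y') <= 2 * eps * (x' - x + (y' - y)) ^ 2.
Proof.
  intros (k & Ax & By & HA & HB).
  destruct (locally_2d_and _ _ _ _ (HA eps) (HB eps)) as [delta Hd].
  exists delta. intros x x' y y' Hx Hy Hxd Hyd Hc.
  assert (E : forall s t, x <= s <= x' -> y <= t <= y' ->
     Rabs (A s t - A u v - (Ax * (s - u) + k * (t - v))) <= eps * (x' - x + (y' - y)) /\
     Rabs (B s t - B u v - (k * (s - u) + By * (t - v))) <= eps * (x' - x + (y' - y))).
  { intros s t Hs Ht.
    assert (M : Rmax (Rabs (s - u)) (Rabs (t - v)) <= x' - x + (y' - y)).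
    { apply Rmax_lub; apply Rabs_le; lra. }
    assert (P := cond_pos eps).
    destruct (Hd s t) as [H1 H2]; [apply Rabs_lt_between; lra|apply Rabs_lt_between; lra|].
    split; (eapply Rle_trans; [eassumption|]); apply Rmult_le_compat_l; lra. }
  assert (P := cond_pos eps).
  unfold loop.
  set (I := RInt _ x x'). set (J := RInt _ y y').
  assert (HI : Rabs (I - (k * (y - y')) * (x' - x)) <=
      (x' - x) * (2 * eps * (x' - x + (y' - y)))).
  { apply RInt_near_const; [lra| |].
    - apply @ex_RInt_minus; apply (ex_RInt_continuous (V := R_CompleteNormedModule)); intros z Hz;
      rewrite Rmin_left, Rmax_right in Hz by lra;
      apply continuity_2d_slice_l, Hc; lra.
    - intros s Hs. destruct (E s y) as [E1 _]; [lra|lra|]. destruct (E s y') as [E2 _]; [lra|lra|].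
      apply Rabs_le_between in E1. apply Rabs_le_between in E2. apply Rabs_le_between. lra. }
  assert (HJ : Rabs (J - (k * (x' - x)) * (y' - y)) <=
      (y' - y) * (2 * eps * (x' - x + (y' - y)))).
  { apply RInt_near_const; [lra| |].
    - apply @ex_RInt_minus; apply (ex_RInt_continuous (V := R_CompleteNormedModule)); intros z Hz;
      rewrite Rmin_left, Rmax_right in Hz by lra;
      apply continuity_2d_slice_r, Hc; lra.
    - intros s Hs. destruct (E x' s) as [_ E1]; [lra|lra|]. destruct (E x s) as [_ E2]; [lra|lra|].
      apply Rabs_le_between in E1. apply Rabs_le_between in E2. apply Rabs_le_between. lra. }
  replace (I + J) with ((I - k * (y - y') * (x' - x)) + (J - k * (x' - x) * (y' - y))) by ring.
  eapply Rle_trans; [apply Rabs_triang|]. nra.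
Qed.

Record rectangle := Rectangle { rleft : R; rright : R; rbottom : R; rtop : R }.

Definition sub_rectangle (q q0 : rectangle) : Prop :=
  rleft q0 <= rleft q <= rright q /\ rright q <= rright q0 /\
  rbottom q0 <= rbottom q <= rtop q /\ rtop q <= rtop q0.

Definition quarter (i j : bool) (q : rectangle) : rectangle :=
  let m := (rleft q + rright q) / 2 in
  let n := (rbottom q + rtop q) / 2 in
  Rectangle (if i then m else rleft q) (if i then rright q else m)
            (if j then n else rbottom q) (if j then rtop q else n).

(** A failure on the whole rectangle is inherited by one of its quarters, and so on; the nested
    failing quarters shrink to a point, near which there is no failure. *)
Lemma rectangle_bisection (P : rectangle -> Prop) (q0 : rectangle)
  (P_dec : forall q, {P q} + {~ P q}) :
  sub_rectangle q0 q0 ->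
  (forall q, sub_rectangle q q0 -> (forall i j, P (quarter i j q)) -> P q) ->
  (forall u v, rleft q0 <= u <= rright q0 -> rbottom q0 <= v <= rtop q0 ->
     exists delta : posreal, forall q, sub_rectangle q q0 ->
       rleft q <= u <= rright q -> rbottom q <= v <= rtop q ->
       rright q - rleft q < delta -> rtop q - rbottom q < delta -> P q) ->
  P q0.
Proof.
  intros Hq0 Hquarter Hlocal.
  destruct (P_dec q0) as [H0|H0]; [exact H0|exfalso].
  (* [next q] is the first of the four quarters of [q] on which [P] fails, if there is one *)
  pose (bad i j q := if P_dec (quarter i j q) then false else true).
  pose (next q := if bad false false q then quarter false false q
             else if bad true false q then quarter true false q
             else if bad false true q then quarter false true q
             else quarter true true q).
  assert (Hnext : forall q, exists i j, next q = quarter i j q).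
  { intros q. unfold next.
    destruct (bad false false q); [eauto|]. destruct (bad true false q); [eauto|].
    destruct (bad false true q); eauto. }
  assert (Hbad : forall q, sub_rectangle q q0 -> ~ P q -> ~ P (next q)).
  { intros q Hq HP HN. apply HP, Hquarter; [exact Hq|].
    unfold next, bad in HN.
    destruct (P_dec (quarter false false q)) as [?|?]; [|now contradict HN].
    destruct (P_dec (quarter true false q)) as [?|?]; [|now contradict HN].
    destruct (P_dec (quarter false true q)) as [?|?]; [|now contradict HN].
    intros [] []; assumption. }
  pose (q n := Nat.iter n next q0).
  assert (HS : forall n, exists i j, q (S n) = quarter i j (q n)) by (intros n; apply Hnext).
  assert (Hsub : forall n, sub_rectangle (q n) q0).
  { induction n as [|n IH]; [exact Hq0|]. destruct (HS n) as (i & j & ->).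
    unfold sub_rectangle in *; destruct i, j; simpl; lra. }
  assert (HPn : forall n, ~ P (q n)).
  { induction n as [|n IH]; [exact H0|]. apply Hbad; auto. }
  assert (Hw : forall n, rright (q n) - rleft (q n) = (rright q0 - rleft q0) * (/ 2) ^ n /\
                         rtop (q n) - rbottom (q n) = (rtop q0 - rbottom q0) * (/ 2) ^ n).
  { induction n as [|n IH]; [simpl; lra|]. destruct (HS n) as (i & j & ->).
    destruct i, j; simpl in *; lra. }
  assert (Hlim : forall c : R, is_lim_seq (fun n => c * (/ 2) ^ n) 0).
  { intros c. replace (Finite 0) with (Rbar_mult c 0) by (simpl; f_equal; ring).
    apply is_lim_seq_scal_l, is_lim_seq_geom. rewrite Rabs_pos_eq; lra. }
  assert (Hmono : forall n, (rleft (q n) <= rleft (q (S n)) /\ rright (q (S n)) <= rright (q n)) /\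
                            (rbottom (q n) <= rbottom (q (S n)) /\ rtop (q (S n)) <= rtop (q n))).
  { intros n. destruct (HS n) as (i & j & ->). specialize (Hsub n).
    unfold sub_rectangle in Hsub; destruct i, j; simpl; lra. }
  destruct (ex_lim_seq_adj (fun n => rleft (q n)) (fun n => rright (q n))) as ([u Hu] & [u' Hu'] & Eu);
    [apply Hmono|apply Hmono| |].
  { eapply is_lim_seq_ext; [|apply Hlim]. intros n. symmetry. apply Hw. }
  destruct (ex_lim_seq_adj (fun n => rbottom (q n)) (fun n => rtop (q n))) as ([v Hv] & [v' Hv'] & Ev);
    [apply Hmono|apply Hmono| |].
  { eapply is_lim_seq_ext; [|apply Hlim]. intros n. symmetry. apply Hw. }
  rewrite (is_lim_seq_unique _ _ Hu), (is_lim_seq_unique _ _ Hu') in Eu.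
  rewrite (is_lim_seq_unique _ _ Hv), (is_lim_seq_unique _ _ Hv') in Ev.
  injection Eu as Eu. injection Ev as Ev. subst u' v'.
  assert (Hin : forall n, rleft (q n) <= u <= rright (q n) /\ rbottom (q n) <= v <= rtop (q n)).
  { intros n. split; split.
    - apply (is_lim_seq_incr_compare (fun n => rleft (q n))); [exact Hu|apply Hmono].
    - apply (is_lim_seq_decr_compare (fun n => rright (q n))); [exact Hu'|apply Hmono].
    - apply (is_lim_seq_incr_compare (fun n => rbottom (q n))); [exact Hv|apply Hmono].
    - apply (is_lim_seq_decr_compare (fun n => rtop (q n))); [exact Hv'|apply Hmono]. }
  destruct (Hlocal u v) as [delta Hd].
  { exact (proj1 (Hin 0%nat)). }
  { exact (proj2 (Hin 0%nat)). }
  destruct (proj2 (is_lim_seq_spec _ _) (Hlim (rright q0 - rleft q0)) delta) as [N1 HN1].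
  destruct (proj2 (is_lim_seq_spec _ _) (Hlim (rtop q0 - rbottom q0)) delta) as [N2 HN2].
  specialize (HN1 (max N1 N2) (Nat.le_max_l _ _)). specialize (HN2 (max N1 N2) (Nat.le_max_r _ _)).
  apply (HPn (max N1 N2)), Hd; try apply Hsub; try apply Hin.
  - rewrite (proj1 (Hw _)). rewrite Rminus_0_r in HN1. eapply Rle_lt_trans; [apply Rle_abs|exact HN1].
  - rewrite (proj2 (Hw _)). rewrite Rminus_0_r in HN2. eapply Rle_lt_trans; [apply Rle_abs|exact HN2].
Qed.

(** The bound [2 eps (width + height)^2] holds for small rectangles around every point and is
    additive under division into quarters: each quarter has half the width and half the height, and
    there are four of them. *)
Lemma goursat (A B : R -> R -> R) (a a' b b' : R) :
  a <= a' -> b <= b' ->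
  (forall x y, a <= x <= a' -> b <= y <= b' -> curl_free_at A B x y) ->
  loop A B a a' b b' = 0.
Proof.
  intros Ha Hb HAB.
  assert (Hc : forall x y, a <= x <= a' -> b <= y <= b' ->
     continuity_2d_pt A x y /\ continuity_2d_pt B x y).
  { intros x y Hx Hy. apply curl_free_continuous, HAB; assumption. }
  assert (K : forall eps : posreal,
    Rabs (loop A B a a' b b') <= 2 * eps * (a' - a + (b' - b)) ^ 2).
  { intros eps.
    pose (P q := Rabs (loop A B (rleft q) (rright q) (rbottom q) (rtop q)) <=
                 2 * eps * (rright q - rleft q + (rtop q - rbottom q)) ^ 2).
    change (P (Rectangle a a' b b')).
    apply rectangle_bisection.
    - intros q. apply Rle_dec.
    - unfold sub_rectangle; simpl; lra.
    - intros [x x' y y'] Hq HP. unfold sub_rectangle in Hq; simpl in Hq. unfold P; simpl.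
      rewrite (loop_quarters A B x x' y y') with (m := (x + x') / 2) (n := (y + y') / 2);
        [|intros; apply Hc; lra|intros; apply Hc; lra|lra|lra].
      generalize (HP false false) (HP true false) (HP false true) (HP true true).
      unfold P; simpl.
      intros H1 H2 H3 H4.
      eapply Rle_trans; [apply Rabs_triang|].
      eapply Rle_trans; [apply Rplus_le_compat_r, Rabs_triang|].
      eapply Rle_trans; [apply Rplus_le_compat_r, Rplus_le_compat_r, Rabs_triang|].
      eapply Rle_trans;
        [apply Rplus_le_compat; [apply Rplus_le_compat; [apply Rplus_le_compat;
           [exact H1|exact H2]|exact H3]|exact H4]|].
      apply Req_le. field.
    - simpl. intros u v Hu Hv.
      destruct (loop_small A B u v eps (HAB u v Hu Hv)) as [delta Hd].
      exists delta. intros [x x' y y'] Hq Hxu Hyv Hx Hy. unfold sub_rectangle in Hq; simpl in *.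
      apply Hd; try assumption. simpl. intros s t Hs Ht. apply Hc; lra. }
  (* the bound holds for every eps; take one that makes it smaller than a non-zero loop integral *)
  destruct (Req_dec (loop A B a a' b b') 0) as [E|E]; [exact E|exfalso].
  apply Rabs_pos_lt in E.
  set (L := Rabs _) in *. set (w := (a' - a + (b' - b)) ^ 2) in *.
  assert (Hw : 0 <= w) by apply pow2_ge_0.
  assert (He : 0 < L / (4 * (w + 1))) by (apply Rdiv_lt_0_compat; lra).
  specialize (K (mkposreal _ He)). simpl in K.
  assert (E1 : 2 * (L / (4 * (w + 1))) * w = L / 2 * (w / (w + 1))) by (field; lra).
  assert (w / (w + 1) < 1).
  { apply Rlt_div_l; lra. }
  rewrite E1 in K. nra.
Qed.

(** Squares rather than discs: a segment from the centre parallel to an axis, followed by one parallel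
    to the other axis, stays inside. *)
Definition in_square (x0 y0 r x y : R) : Prop := Rabs (x - x0) < r /\ Rabs (y - y0) < r.

Lemma RInt_reverse (f : R -> R) (a b : R) : ex_RInt f a b -> RInt f b a = - RInt f a b.
Proof. intros H. symmetry. exact (opp_RInt_swap (V := R_CompleteNormedModule) f a b H). Qed.

Lemma goursat_oriented (A B : R -> R -> R) (a a' b b' : R) :
  (forall x y, Rmin a a' <= x <= Rmax a a' -> Rmin b b' <= y <= Rmax b b' -> curl_free_at A B x y) ->
  loop A B a a' b b' = 0.
Proof.
  intros H.
  assert (Hc : forall x y, Rmin a a' <= x <= Rmax a a' -> Rmin b b' <= y <= Rmax b b' ->
     continuity_2d_pt A x y /\ continuity_2d_pt B x y).
  { intros x y Hx Hy. apply curl_free_continuous, H; assumption. }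
  pose proof (loop_sides A B _ _ _ _ (fun x y Hx Hy => proj1 (Hc x y Hx Hy))
                (fun x y Hx Hy => proj2 (Hc x y Hx Hy))) as HL.
  pose proof (ex_RInt_horizontal A _ _ _ _ (fun x y Hx Hy => proj1 (Hc x y Hx Hy))) as EA.
  pose proof (ex_RInt_vertical B _ _ _ _ (fun x y Hx Hy => proj2 (Hc x y Hx Hy))) as EB.
  assert (G : loop A B (Rmin a a') (Rmax a a') (Rmin b b') (Rmax b b') = 0).
  { apply goursat; [apply Rminmax|apply Rminmax|exact H]. }
  clear H Hc. revert G HL EA EB.
  unfold Rmin, Rmax. destruct (Rle_dec a a') as [Ha|Ha], (Rle_dec b b') as [Hb|Hb];
    intros G HL EA EB; rewrite HL in G |- * by lra.
  - exact G.
  - rewrite (RInt_reverse (fun t => B a t) b' b), (RInt_reverse (fun t => B a' t) b' b);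
      [lra|apply EB; lra|apply EB; lra].
  - rewrite (RInt_reverse (fun t => A t b) a' a), (RInt_reverse (fun t => A t b') a' a);
      [lra|apply EA; lra|apply EA; lra].
  - rewrite (RInt_reverse (fun t => B a t) b' b), (RInt_reverse (fun t => B a' t) b' b);
      [|apply EB; lra|apply EB; lra].
    rewrite (RInt_reverse (fun t => A t b) a' a), (RInt_reverse (fun t => A t b') a' a);
      [lra|apply EA; lra|apply EA; lra].
Qed.

Lemma in_square_open (x0 y0 r x y : R) :
  in_square x0 y0 r x y -> locally_2d (in_square x0 y0 r) x y.
Proof.
  intros [Hx Hy].
  assert (H : 0 < Rmin (r - Rabs (x - x0)) (r - Rabs (y - y0))) by (apply Rmin_glb_lt; lra).
  exists (mkposreal _ H). simpl. intros u v Hu Hv.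
  pose proof (Rmin_l (r - Rabs (x - x0)) (r - Rabs (y - y0))).
  pose proof (Rmin_r (r - Rabs (x - x0)) (r - Rabs (y - y0))).
  pose proof (Rabs_triang (u - x) (x - x0)). pose proof (Rabs_triang (v - y) (y - y0)).
  split.
  - replace (u - x0) with (u - x + (x - x0)) by ring. lra.
  - replace (v - y0) with (v - y + (y - y0)) by ring. lra.
Qed.

Lemma between_in_interval (c r x s : R) :
  Rabs (x - c) < r -> Rmin c x <= s <= Rmax c x -> Rabs (s - c) < r.
Proof.
  intros Hx Hs. apply Rabs_lt_between in Hx. apply Rabs_lt_between.
  revert Hs. unfold Rmin, Rmax. destruct (Rle_dec c x); lra.
Qed.

Lemma is_derive_const_plus (c : R) (g : R -> R) (x l : R) :
  is_derive g x l -> is_derive (fun s => c + g s) x l.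
Proof.
  intros H. rewrite <- (Rplus_0_l l).
  exact (is_derive_plus (fun _ => c) g x 0 l (is_derive_const c x) H).
Qed.

(** The potential is the integral along a horizontal and then a vertical segment, which has the right
    derivative in [y]; as loop integrals vanish, it is also the integral along the vertical and then
    the horizontal segment, which has the right derivative in [x]. *)
Lemma potential (A B : R -> R -> R) (x0 y0 r : R) :
  (forall x y, in_square x0 y0 r x y -> curl_free_at A B x y) ->
  exists U, forall x y, in_square x0 y0 r x y -> differentiable_pt_lim U x y (A x y) (B x y).
Proof.
  intros H.
  assert (Hc : forall x y, in_square x0 y0 r x y ->
     continuity_2d_pt A x y /\ continuity_2d_pt B x y).
  { intros x y Hxy. apply curl_free_continuous, H, Hxy. }
  assert (EA : forall x y, in_square x0 y0 r x y -> ex_RInt (fun s => A s y) x0 x).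
  { intros x y [Hx Hy]. apply (ex_RInt_continuous (V := R_CompleteNormedModule)).
    intros s Hs. apply continuity_2d_slice_l, Hc. split; [|exact Hy].
    eapply between_in_interval; eassumption. }
  assert (EB : forall x y, in_square x0 y0 r x y -> ex_RInt (fun t => B x t) y0 y).
  { intros x y [Hx Hy]. apply (ex_RInt_continuous (V := R_CompleteNormedModule)).
    intros s Hs. apply continuity_2d_slice_r, Hc. split; [exact Hx|].
    eapply between_in_interval; eassumption. }
  exists (fun x y => RInt (fun s => A s y0) x0 x + RInt (fun t => B x t) y0 y).
  assert (E : forall x y, in_square x0 y0 r x y ->
    RInt (fun s => A s y0) x0 x + RInt (fun t => B x t) y0 y =
    RInt (fun t => B x0 t) y0 y + RInt (fun s => A s y) x0 x).
  { intros x y Hxy.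
    assert (Hsub : forall s t, Rmin x0 x <= s <= Rmax x0 x -> Rmin y0 y <= t <= Rmax y0 y ->
       in_square x0 y0 r s t).
    { intros s t Hs Ht. destruct Hxy. split; eapply between_in_interval; eassumption. }
    assert (G : loop A B x0 x y0 y = 0).
    { apply goursat_oriented. intros s t Hs Ht. apply H, Hsub; assumption. }
    rewrite (loop_sides A B (Rmin x0 x) (Rmax x0 x) (Rmin y0 y) (Rmax y0 y)) in G.
    - lra.
    - intros s t Hs Ht. apply Hc, Hsub; assumption.
    - intros s t Hs Ht. apply Hc, Hsub; assumption.
    - split; [apply Rmin_l|apply Rmax_l].
    - split; [apply Rmin_r|apply Rmax_r].
    - split; [apply Rmin_l|apply Rmax_l].
    - split; [apply Rmin_r|apply Rmax_r]. }
  assert (DX : forall x y, in_square x0 y0 r x y ->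
     is_derive (fun x => RInt (fun s => A s y0) x0 x + RInt (fun t => B x t) y0 y) x (A x y)).
  { intros x y Hxy.
    assert (L : locally x (fun x => in_square x0 y0 r x y)).
    { apply (locally_2d_1d_const_y (in_square x0 y0 r)), in_square_open, Hxy. }
    apply is_derive_ext_loc with (fun x => RInt (fun t => B x0 t) y0 y + RInt (fun s => A s y) x0 x).
    - revert L. apply filter_imp. intros s Hs. symmetry. apply E, Hs.
    - apply is_derive_const_plus.
      apply (is_derive_RInt (fun s => A s y) _ x0).
      + revert L. apply filter_imp. intros s Hs. apply (RInt_correct (V := R_CompleteNormedModule)), EA, Hs.
      + apply continuity_2d_slice_l, Hc, Hxy. }
  assert (DY : forall x y, in_square x0 y0 r x y ->
     is_derive (fun y => RInt (fun s => A s y0) x0 x + RInt (fun t => B x t) y0 y) y (B x y)).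
  { intros x y Hxy.
    assert (L : locally y (fun y => in_square x0 y0 r x y)).
    { apply (locally_2d_1d_const_x (in_square x0 y0 r)), in_square_open, Hxy. }
    apply is_derive_const_plus.
    apply (is_derive_RInt (fun s => B x s) _ y0).
    + revert L. apply filter_imp. intros s Hs. apply (RInt_correct (V := R_CompleteNormedModule)), EB, Hs.
    + apply continuity_2d_slice_r, Hc, Hxy. }
  intros x y Hxy. apply filterdiff_differentiable_pt_lim.
  apply (is_derive_filterdiff (fun x y => RInt (fun s => A s y0) x0 x + RInt (fun t => B x t) y0 y)
     x y A (B x y)).
  - apply (locally_2d_locally (fun u v => is_derive (fun z => RInt (fun s => A s y0) x0 z + RInt (fun t => B z t) y0 v) u (A u v))).
    generalize (in_square_open _ _ _ _ _ Hxy). apply locally_2d_impl, locally_2d_forall.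
    intros u v. apply DX.
  - apply DY, Hxy.
  - apply continuity_2d_pt_filterlim, Hc, Hxy.
Qed.

(** * Mean values and regularity *)

Lemma continuity_2d_comp (f g h : R -> R -> R) (x y : R) :
  continuity_2d_pt f (g x y) (h x y) -> continuity_2d_pt g x y -> continuity_2d_pt h x y ->
  continuity_2d_pt (fun u v => f (g u v) (h u v)) x y.
Proof.
  rewrite !continuity_2d_pt_filterlim. intros Hf Hg Hh.
  exact (continuous_comp_2 (fun z : R * R => g (fst z) (snd z)) (fun z => h (fst z) (snd z)) f
    (x, y) Hg Hh Hf).
Qed.

Lemma continuity_2d_pt_cos (x t : R) : continuity_2d_pt (fun _ t => cos t) x t.
Proof.
  apply (continuity_1d_2d_pt_comp cos (fun _ v => v)); [apply continuity_cos|apply continuity_2d_pt_id2].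
Qed.

Lemma continuity_2d_pt_sin (x t : R) : continuity_2d_pt (fun _ t => sin t) x t.
Proof.
  apply (continuity_1d_2d_pt_comp sin (fun _ v => v)); [apply continuity_sin|apply continuity_2d_pt_id2].
Qed.

Lemma continuity_2d_pt_plus_mult (f g h : R -> R -> R) (x y : R) :
  continuity_2d_pt f x y -> continuity_2d_pt g x y -> continuity_2d_pt h x y ->
  continuity_2d_pt (fun u v => f u v + g u v * h u v) x y.
Proof. intros. apply continuity_2d_pt_plus; [|apply continuity_2d_pt_mult]; assumption. Qed.

Lemma is_derive_RInt_smooth_param (G dG : R -> R -> R) (a b l0 : R) :
  locally l0 (fun l => forall t, is_derive (fun l => G l t) l (dG l t)) ->
  (forall t, continuity_2d_pt dG l0 t) ->
  locally l0 (fun l => forall t, continuous (G l) t) ->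
  is_derive (fun l => RInt (G l) a b) l0 (RInt (dG l0) a b).
Proof.
  intros HD HdG HG.
  assert (E : RInt (dG l0) a b = RInt (fun t => Derive (fun l => G l t) l0) a b).
  { apply RInt_ext. intros t _. symmetry. apply is_derive_unique.
    apply (locally_singleton _ _ HD). }
  rewrite E. apply (is_derive_RInt_param G).
  - revert HD. apply filter_imp. intros l Hl t _. eexists. apply Hl.
  - intros t _. eapply continuity_2d_pt_ext_loc; [|apply HdG].
    destruct HD as [d Hd]. exists d. intros u v Hu _. symmetry. apply is_derive_unique.
    apply (Hd u). exact Hu.
  - revert HG. apply filter_imp. intros l Hl.
    apply (ex_RInt_continuous (V := R_CompleteNormedModule)). intros t _. apply Hl.
Qed.

Lemma is_derive_comp_2d (f : R -> R -> R) (g h : R -> R) (t fx fy g' h' : R) :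
  differentiable_pt_lim f (g t) (h t) fx fy -> is_derive g t g' -> is_derive h t h' ->
  is_derive (fun s => f (g s) (h s)) t (fx * g' + fy * h').
Proof. rewrite !is_derive_Reals. apply derivable_pt_lim_comp_2d. Qed.

Lemma is_derive_dot (f g h k : R -> R) (t f' g' h' k' : R) :
  is_derive f t f' -> is_derive g t g' -> is_derive h t h' -> is_derive k t k' ->
  is_derive (fun s => f s * h s + g s * k s) t
    (f' * h t + f t * h' + (g' * k t + g t * k')).
Proof.
  rewrite !is_derive_Reals. intros Hf Hg Hh Hk.
  apply (derivable_pt_lim_plus (f * h)%F (g * k)%F); apply derivable_pt_lim_mult; assumption.
Qed.

Lemma in_square_circle (x0 y0 r x y l t : R) :
  Rabs (x - x0) + Rabs l < r -> Rabs (y - y0) + Rabs l < r ->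
  in_square x0 y0 r (x + l * cos t) (y + l * sin t).
Proof.
  intros Hx Hy.
  assert (Hc : Rabs (l * cos t) <= Rabs l).
  { rewrite Rabs_mult. rewrite <- (Rmult_1_r (Rabs l)) at 2.
    apply Rmult_le_compat_l; [apply Rabs_pos|]. apply Rabs_le, COS_bound. }
  assert (Hs : Rabs (l * sin t) <= Rabs l).
  { rewrite Rabs_mult. rewrite <- (Rmult_1_r (Rabs l)) at 2.
    apply Rmult_le_compat_l; [apply Rabs_pos|]. apply Rabs_le, SIN_bound. }
  split.
  - replace (x + l * cos t - x0) with (x - x0 + l * cos t) by ring.
    eapply Rle_lt_trans; [apply Rabs_triang|]. lra.
  - replace (y + l * sin t - y0) with (y - y0 + l * sin t) by ring.
    eapply Rle_lt_trans; [apply Rabs_triang|]. lra.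
Qed.

Lemma in_square_room (x0 y0 r l x y : R) :
  0 < l -> in_square x0 y0 (r - l) x y -> Rabs (x - x0) + Rabs l < r /\ Rabs (y - y0) + Rabs l < r.
Proof. intros Hl [Hx Hy]. rewrite (Rabs_pos_eq l); lra. Qed.

Lemma circle_room_open (x0 y0 r x y l : R) :
  Rabs (x - x0) + Rabs l < r -> Rabs (y - y0) + Rabs l < r ->
  locally l (fun l => Rabs (x - x0) + Rabs l < r /\ Rabs (y - y0) + Rabs l < r).
Proof.
  intros Hx Hy.
  assert (H : 0 < Rmin (r - Rabs (x - x0) - Rabs l) (r - Rabs (y - y0) - Rabs l))
    by (apply Rmin_glb_lt; lra).
  exists (mkposreal _ H). intros u Hu. unfold ball in Hu; simpl in Hu.
  unfold AbsRing_ball, abs, minus, plus, opp in Hu; simpl in Hu.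
  pose proof (Rmin_l (r - Rabs (x - x0) - Rabs l) (r - Rabs (y - y0) - Rabs l)).
  pose proof (Rmin_r (r - Rabs (x - x0) - Rabs l) (r - Rabs (y - y0) - Rabs l)).
  pose proof (Rabs_triang_inv u l). unfold Rminus in *. lra.
Qed.

Definition continuous_on_square (x0 y0 r : R) (w : R -> R -> R) : Prop :=
  forall x y, in_square x0 y0 r x y -> continuity_2d_pt w x y.

Definition CR_on_square (x0 y0 r : R) (U V p q : R -> R -> R) : Prop :=
  forall x y, in_square x0 y0 r x y -> CR_differentiable U V x y (p x y) (q x y).

Lemma CR_on_square_continuous (U V p q : R -> R -> R) (x0 y0 r : R) :
  CR_on_square x0 y0 r U V p q ->
  continuous_on_square x0 y0 r U /\ continuous_on_square x0 y0 r V.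
Proof.
  intros H. split; intros x y Hxy; destruct (H x y Hxy) as [HU HV];
    eapply differentiable_continuity; eassumption.
Qed.

Lemma circle_continuity_angle (x0 y0 r : R) (w : R -> R -> R) (x y l : R) :
  continuous_on_square x0 y0 r w ->
  Rabs (x - x0) + Rabs l < r -> Rabs (y - y0) + Rabs l < r ->
  forall t, continuous (fun t => w (x + l * cos t) (y + l * sin t)) t.
Proof.
  intros Hw Hx Hy t.
  apply (continuous_comp_2 (fun t => x + l * cos t) (fun t => y + l * sin t) w).
  - apply (ex_derive_continuous (fun t => x + l * cos t)). auto_derive. auto.
  - apply (ex_derive_continuous (fun t => y + l * sin t)). auto_derive. auto.
  - apply continuity_2d_pt_filterlim, Hw, in_square_circle; assumption.
Qed.

(** Real part of [F (z + l e^(i t)) e^(- i t)] for [F = U + i V] and [z = x + i y]. *)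
Definition dipole (U V : R -> R -> R) (x y l t : R) : R :=
  U (x + l * cos t) (y + l * sin t) * cos t + V (x + l * cos t) (y + l * sin t) * sin t.

Lemma dipole_continuous (U V : R -> R -> R) (x0 y0 r x y l : R) :
  continuous_on_square x0 y0 r U -> continuous_on_square x0 y0 r V ->
  Rabs (x - x0) + Rabs l < r -> Rabs (y - y0) + Rabs l < r ->
  forall t, continuous (dipole U V x y l) t.
Proof.
  intros HU HV Hx Hy t. unfold dipole.
  apply @continuous_plus; apply (continuous_mult (K := R_AbsRing)).
  - apply (circle_continuity_angle x0 y0 r U); assumption.
  - apply continuous_cos.
  - apply (circle_continuity_angle x0 y0 r V); assumption.
  - apply continuous_sin.
Qed.

Lemma ex_RInt_dipole (U V : R -> R -> R) (x0 y0 r x y l : R) :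
  continuous_on_square x0 y0 r U -> continuous_on_square x0 y0 r V ->
  Rabs (x - x0) + Rabs l < r -> Rabs (y - y0) + Rabs l < r ->
  ex_RInt (dipole U V x y l) 0 (2 * PI).
Proof.
  intros HU HV Hx Hy. apply (ex_RInt_continuous (V := R_CompleteNormedModule)).
  intros t _. apply (dipole_continuous U V x0 y0 r); assumption.
Qed.

(** With [F = U + i V] and [F' = p + i q], the derivative of [F (z + l e^(i t)) e^(- i t)] in [l]
    is [F' (z + l e^(i t))]: the two exponentials cancel. *)
Lemma dipole_derive_radius (U V p q : R -> R -> R) (x0 y0 r x y l t : R) :
  CR_on_square x0 y0 r U V p q ->
  Rabs (x - x0) + Rabs l < r -> Rabs (y - y0) + Rabs l < r ->
  is_derive (fun l => dipole U V x y l t) l (p (x + l * cos t) (y + l * sin t)).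
Proof.
  intros HUV Hx Hy.
  destruct (HUV _ _ (in_square_circle _ _ _ _ _ _ t Hx Hy)) as [DU DV].
  assert (Dc : is_derive (fun l => x + l * cos t) l (cos t)) by (auto_derive; [trivial|ring]).
  assert (Ds : is_derive (fun l => y + l * sin t) l (sin t)) by (auto_derive; [trivial|ring]).
  pose proof (is_derive_comp_2d U _ _ _ _ _ _ _ DU Dc Ds) as EU.
  pose proof (is_derive_comp_2d V _ _ _ _ _ _ _ DV Dc Ds) as EV.
  unfold dipole.
  set (P := p _ _) in *. set (Q := q _ _) in *.
  evar_last.
  - apply (is_derive_dot _ _ (fun _ => cos t) (fun _ => sin t) l _ _ 0 0 EU EV);
      apply is_derive_Reals, derivable_pt_lim_const.
  - transitivity (P * (Rsqr (sin t) + Rsqr (cos t))); [unfold Rsqr; ring|rewrite sin2_cos2; ring].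
Qed.

(** The derivative of [F (z + l e^(i t)) e^(- i t)] in the angle is [i] times the difference of
    [l F' (z + l e^(i t))] and the function itself; its integral over a full turn vanishes. *)
Lemma dipole_RInt (U V p q : R -> R -> R) (x0 y0 r x y l : R) :
  CR_on_square x0 y0 r U V p q -> continuous_on_square x0 y0 r p ->
  Rabs (x - x0) + Rabs l < r -> Rabs (y - y0) + Rabs l < r ->
  RInt (dipole U V x y l) 0 (2 * PI) =
  l * RInt (fun t => p (x + l * cos t) (y + l * sin t)) 0 (2 * PI).
Proof.
  intros HUV Hp Hx Hy.
  destruct (CR_on_square_continuous _ _ _ _ _ _ _ HUV) as [HU HV].
  (* imaginary part of F (z + l e^(i t)) e^(- i t) *)
  pose (G t := V (x + l * cos t) (y + l * sin t) * cos t + U (x + l * cos t) (y + l * sin t) * - sin t).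
  pose (pc t := p (x + l * cos t) (y + l * sin t)).
  assert (Cp : forall t, continuous pc t) by (apply (circle_continuity_angle x0 y0 r p); assumption).
  assert (HI : is_RInt (fun t => l * pc t - dipole U V x y l t) 0 (2 * PI) (G (2 * PI) - G 0)).
  { apply (is_RInt_derive (V := R_CompleteNormedModule) G).
    - intros t _.
      destruct (HUV _ _ (in_square_circle _ _ _ _ _ _ t Hx Hy)) as [DU DV].
      assert (Dc : is_derive (fun t => x + l * cos t) t (- l * sin t)) by (auto_derive; [trivial|ring]).
      assert (Ds : is_derive (fun t => y + l * sin t) t (l * cos t)) by (auto_derive; [trivial|ring]).
      pose proof (is_derive_comp_2d U _ _ _ _ _ _ _ DU Dc Ds) as EU.
      pose proof (is_derive_comp_2d V _ _ _ _ _ _ _ DV Dc Ds) as EV.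
      unfold G, pc, dipole.
      set (P := p _ _) in *. set (Q := q _ _) in *.
      evar_last.
      + apply (is_derive_dot _ _ cos (fun t => - sin t) t _ _ (- sin t) (- cos t) EV EU);
          [apply is_derive_cos|auto_derive; [trivial|ring]].
      + rewrite <- (Rmult_1_r (l * P)), <- (sin2_cos2 t). unfold Rsqr. ring.
    - intros t _. apply @continuous_minus.
      + apply (continuous_mult (K := R_AbsRing)); [apply continuous_const|apply Cp].
      + apply (dipole_continuous U V x0 y0 r); assumption. }
  assert (Ep : ex_RInt pc 0 (2 * PI)).
  { apply (ex_RInt_continuous (V := R_CompleteNormedModule)). intros t _. apply Cp. }
  assert (Ed : ex_RInt (dipole U V x y l) 0 (2 * PI))
    by (apply (ex_RInt_dipole U V x0 y0 r); assumption).
  apply (is_RInt_unique (V := R_CompleteNormedModule)) in HI.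
  rewrite (RInt_sub (fun t => l * pc t) (dipole U V x y l)) in HI;
    [|apply @ex_RInt_scal; exact Ep|exact Ed].
  assert (Es : RInt (fun t => l * pc t) 0 (2 * PI) = l * RInt pc 0 (2 * PI))
    by exact (RInt_scal (V := R_CompleteNormedModule) pc 0 (2 * PI) l Ep).
  rewrite Es in HI.
  unfold G in HI. rewrite cos_2PI, sin_2PI, cos_0, sin_0 in HI. fold pc. lra.
Qed.

Lemma dipole_RInt_derive_radius (U V p q : R -> R -> R) (x0 y0 r x y l : R) :
  CR_on_square x0 y0 r U V p q -> continuous_on_square x0 y0 r p ->
  Rabs (x - x0) + Rabs l < r -> Rabs (y - y0) + Rabs l < r ->
  is_derive (fun l => RInt (dipole U V x y l) 0 (2 * PI)) l
    (RInt (fun t => p (x + l * cos t) (y + l * sin t)) 0 (2 * PI)).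
Proof.
  intros HUV Hp Hx Hy.
  destruct (CR_on_square_continuous _ _ _ _ _ _ _ HUV) as [HU HV].
  apply (is_derive_RInt_smooth_param (dipole U V x y) (fun l t => p (x + l * cos t) (y + l * sin t))).
  - generalize (circle_room_open _ _ _ _ _ _ Hx Hy). apply filter_imp.
    intros u [Hux Huy] t. apply (dipole_derive_radius U V p q x0 y0 r); assumption.
  - intros t.
    apply (continuity_2d_comp p (fun l t => x + l * cos t) (fun l t => y + l * sin t)).
    + apply Hp, in_square_circle; assumption.
    + apply continuity_2d_pt_plus_mult;
        [apply continuity_2d_pt_const|apply continuity_2d_pt_id1|apply continuity_2d_pt_cos].
    + apply continuity_2d_pt_plus_mult;
        [apply continuity_2d_pt_const|apply continuity_2d_pt_id1|apply continuity_2d_pt_sin].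
  - generalize (circle_room_open _ _ _ _ _ _ Hx Hy). apply filter_imp.
    intros u [Hux Huy] t. apply (dipole_continuous U V x0 y0 r); assumption.
Qed.

(** Write [K l] for the integral of the dipole and [M l] for the integral of [p] over the circle of
    radius [l].  Then [K = l M] and [K' = M], so [K / l = M] has derivative zero on the positive
    radii; its value is the limit [2 pi p (x, y)] at radius zero. *)
Lemma mean_value (U V p q : R -> R -> R) (x0 y0 r x y l : R) :
  CR_on_square x0 y0 r U V p q -> continuous_on_square x0 y0 r p ->
  0 < l -> Rabs (x - x0) + l < r -> Rabs (y - y0) + l < r ->
  RInt (dipole U V x y l) 0 (2 * PI) = 2 * PI * l * p x y.
Proof.
  intros HUV Hp Hl Hx Hy.
  pose (M := (fun l => RInt (fun t => p (x + l * cos t) (y + l * sin t)) 0 (2 * PI)) : R -> R).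
  pose (K := (fun l => RInt (dipole U V x y l) 0 (2 * PI)) : R -> R).
  assert (Hr : forall k, 0 < k <= l -> Rabs (x - x0) + Rabs k < r /\ Rabs (y - y0) + Rabs k < r).
  { intros k Hk. rewrite (Rabs_pos_eq k); lra. }
  assert (HK : forall k, 0 < k <= l -> K k = k * M k).
  { intros k Hk. destruct (Hr k Hk). apply (dipole_RInt U V p q x0 y0 r); assumption. }
  assert (Hconst : forall k, 0 < k < l -> M k = M l).
  { intros k Hk.
    assert (E : K k / k = K l / l).
    { apply (eq_is_derive (fun k => K k / k)); [|apply Hk]. intros t Ht.
      destruct (Hr t) as [Htx Hty]; [lra|].
      assert (D : is_derive K t (M t))
        by (apply (dipole_RInt_derive_radius U V p q x0 y0 r); assumption).
      evar_last.
      - apply is_derive_div; [exact D|apply is_derive_id|lra].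
      - rewrite HK by lra. unfold zero, one; simpl. field. lra. }
    rewrite !HK in E by lra.
    replace (k * M k / k) with (M k) in E by (field; lra). rewrite E. field. lra. }
  assert (HM : M l = 2 * PI * p x y).
  { apply cond_eq. intros eps He. pose proof PI_RGT_0 as HPI.
    assert (He' : 0 < eps / (4 * PI)) by (apply Rdiv_lt_0_compat; lra).
    destruct (Hp x y) with (mkposreal _ He') as [d Hd].
    { split; lra. }
    pose (k := Rmin (d / 2) (l / 2)).
    assert (Hk : 0 < k < l /\ k < d).
    { pose proof (cond_pos d). unfold k. split; [split|].
      - apply Rmin_glb_lt; lra.
      - eapply Rle_lt_trans; [apply Rmin_r|]; lra.
      - eapply Rle_lt_trans; [apply Rmin_l|]; lra. }
    rewrite <- (Hconst k) by apply Hk.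
    destruct (Hr k) as [Hkx Hky]; [lra|].
    replace (2 * PI * p x y) with (p x y * (2 * PI - 0)) by ring.
    eapply Rle_lt_trans; [apply (RInt_near_const _ 0 (2 * PI) (p x y) (eps / (4 * PI)))|].
    - lra.
    - apply (ex_RInt_continuous (V := R_CompleteNormedModule)). intros t _.
      apply (circle_continuity_angle x0 y0 r p); assumption.
    - intros t _. left.
      assert (Q : in_square x y d (x + k * cos t) (y + k * sin t)).
      { apply in_square_circle; rewrite Rminus_diag, Rabs_R0, (Rabs_pos_eq k); lra. }
      apply Hd; apply Q.
    - apply Rle_lt_trans with (eps / 2); [apply Req_le; field; lra|lra]. }
  change (@eq R (K l) (2 * PI * l * p x y)). rewrite HK, HM by lra. ring.
Qed.

(** All the circles with centre near [(x, y)] lie in one closed square, on which [p] and [q] are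
    uniformly continuous. *)
Lemma dipole_RInt_continuous (p q : R -> R -> R) (x0 y0 r l : R) :
  continuous_on_square x0 y0 r p -> continuous_on_square x0 y0 r q -> 0 < l ->
  continuous_on_square x0 y0 (r - l) (fun x y => RInt (dipole p q x y l) 0 (2 * PI)).
Proof.
  intros Hp Hq Hl x y Hxy.
  set (h := (Rmin (r - l - Rabs (x - x0)) (r - l - Rabs (y - y0))) / 2).
  assert (Hh : 0 < h /\ Rabs (x - x0) + h + l < r /\ Rabs (y - y0) + h + l < r).
  { destruct Hxy as [Hx Hy]. unfold h.
    assert (0 < Rmin (r - l - Rabs (x - x0)) (r - l - Rabs (y - y0))) by (apply Rmin_glb_lt; lra).
    pose proof (Rmin_l (r - l - Rabs (x - x0)) (r - l - Rabs (y - y0))).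
    pose proof (Rmin_r (r - l - Rabs (x - x0)) (r - l - Rabs (y - y0))). lra. }
  assert (Hin : forall u v, x - (h + l) <= u <= x + (h + l) -> y - (h + l) <= v <= y + (h + l) ->
     in_square x0 y0 r u v).
  { intros u v Hu Hv.
    assert (Rabs (u - x) <= h + l) by (apply Rabs_le; lra).
    assert (Rabs (v - y) <= h + l) by (apply Rabs_le; lra).
    pose proof (Rabs_triang (u - x) (x - x0)). pose proof (Rabs_triang (v - y) (y - y0)).
    split.
    - replace (u - x0) with (u - x + (x - x0)) by ring. lra.
    - replace (v - y0) with (v - y + (y - y0)) by ring. lra. }
  intros eps. pose proof PI_RGT_0 as HPI. pose proof (cond_pos eps).
  assert (He : 0 < eps / (8 * PI)) by (apply Rdiv_lt_0_compat; lra).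
  destruct (uniform_continuity_2d p (x - (h + l)) (x + (h + l)) (y - (h + l)) (y + (h + l)))
    with (mkposreal _ He) as [d1 Hd1]; [intros u v Hu Hv; apply Hp, Hin; assumption|].
  destruct (uniform_continuity_2d q (x - (h + l)) (x + (h + l)) (y - (h + l)) (y + (h + l)))
    with (mkposreal _ He) as [d2 Hd2]; [intros u v Hu Hv; apply Hq, Hin; assumption|].
  assert (Hd : 0 < Rmin h (Rmin d1 d2)).
  { apply Rmin_glb_lt; [apply Hh|]. apply Rmin_glb_lt; apply cond_pos. }
  exists (mkposreal _ Hd). simpl. intros u v Hu Hv.
  pose proof (Rmin_l h (Rmin d1 d2)). pose proof (Rmin_r h (Rmin d1 d2)).
  pose proof (Rmin_l d1 d2). pose proof (Rmin_r d1 d2).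
  assert (Ex : forall u v, Rabs (u - x) < h -> Rabs (v - y) < h ->
     ex_RInt (dipole p q u v l) 0 (2 * PI)).
  { intros u' v' Hu' Hv'.
    pose proof (Rabs_triang (u' - x) (x - x0)). pose proof (Rabs_triang (v' - y) (y - y0)).
    apply (ex_RInt_dipole p q x0 y0 r); try assumption.
    - replace (u' - x0) with (u' - x + (x - x0)) by ring. rewrite (Rabs_pos_eq l); lra.
    - replace (v' - y0) with (v' - y + (y - y0)) by ring. rewrite (Rabs_pos_eq l); lra. }
  assert (E1 : ex_RInt (dipole p q u v l) 0 (2 * PI)) by (apply Ex; lra).
  assert (E2 : ex_RInt (dipole p q x y l) 0 (2 * PI))
    by (apply Ex; rewrite Rminus_diag, Rabs_R0; lra).
  rewrite <- RInt_sub by assumption.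
  apply Rle_lt_trans with ((2 * PI - 0) * (2 * (eps / (8 * PI)))).
  - apply abs_RInt_le_const; [lra|apply @ex_RInt_minus; assumption|].
    intros t _. unfold dipole.
    pose proof (COS_bound t) as Ht1. pose proof (SIN_bound t) as Ht2.
    assert (Bc : forall s, -1 <= s <= 1 -> - l <= l * s <= l) by (intros s Hs; nra).
    pose proof (Bc _ Ht1) as Bcos. pose proof (Bc _ Ht2) as Bsin.
    apply Rabs_lt_between in Hu. apply Rabs_lt_between in Hv.
    assert (P : Rabs (p (u + l * cos t) (v + l * sin t) - p (x + l * cos t) (y + l * sin t)) < eps / (8 * PI)).
    { apply Hd1; try lra; apply Rabs_lt_between; lra. }
    assert (Q : Rabs (q (u + l * cos t) (v + l * sin t) - q (x + l * cos t) (y + l * sin t)) < eps / (8 * PI)).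
    { apply Hd2; try lra; apply Rabs_lt_between; lra. }
    set (P1 := p (u + _) _) in *. set (P2 := p (x + _) _) in *.
    set (Q1 := q (u + _) _) in *. set (Q2 := q (x + _) _) in *.
    replace (P1 * cos t + Q1 * sin t - (P2 * cos t + Q2 * sin t)) with
      ((P1 - P2) * cos t + (Q1 - Q2) * sin t) by ring.
    eapply Rle_trans; [apply Rabs_triang|]. rewrite !Rabs_mult.
    assert (Rabs (cos t) <= 1) by (apply Rabs_le; lra).
    assert (Rabs (sin t) <= 1) by (apply Rabs_le; lra).
    pose proof (Rabs_pos (P1 - P2)). pose proof (Rabs_pos (Q1 - Q2)).
    pose proof (Rabs_pos (cos t)). pose proof (Rabs_pos (sin t)). nra.
  - replace ((2 * PI - 0) * (2 * (eps / (8 * PI)))) with (eps / 2) by (field; lra). lra.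
Qed.

(** The mean value formula expresses [p], which is only known to be continuous, by an integral of
    the differentiable functions [U] and [V]; the partial derivatives of [p] are obtained under the
    integral sign. *)
Lemma mean_value_derive (U V p q : R -> R -> R) (x0 y0 r l : R) :
  CR_on_square x0 y0 r U V p q ->
  continuous_on_square x0 y0 r p -> continuous_on_square x0 y0 r q ->
  0 < l -> forall x y, in_square x0 y0 (r - l) x y ->
  is_derive (fun x => p x y) x (/ (2 * PI * l) * RInt (dipole p q x y l) 0 (2 * PI)) /\
  is_derive (fun y => p x y) y (/ (2 * PI * l) * RInt (dipole (fun x y => - q x y) p x y l) 0 (2 * PI)).
Proof.
  intros HUV Hp Hq Hl x y Hxy. pose proof PI_RGT_0 as HPI.
  destruct (CR_on_square_continuous _ _ _ _ _ _ _ HUV) as [HU HV].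
  assert (Hcirc : forall x y, in_square x0 y0 (r - l) x y -> forall t,
    in_square x0 y0 r (x + l * cos t) (y + l * sin t)).
  { intros x' y' H' t. destruct (in_square_room _ _ _ _ _ _ Hl H'). apply in_square_circle; assumption. }
  assert (Hmv : forall x y, in_square x0 y0 (r - l) x y ->
     p x y = / (2 * PI * l) * RInt (dipole U V x y l) 0 (2 * PI)).
  { intros x' y' [H1 H2]. rewrite (mean_value U V p q x0 y0 r) by (assumption || lra). field. lra. }
  assert (Hdip : forall x y, in_square x0 y0 (r - l) x y -> forall t, continuous (dipole U V x y l) t).
  { intros x' y' H' t. destruct (in_square_room _ _ _ _ _ _ Hl H').
    apply (dipole_continuous U V x0 y0 r); assumption. }
  split.
  - assert (L : locally x (fun x => in_square x0 y0 (r - l) x y)).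
    { apply (locally_2d_1d_const_y (in_square x0 y0 (r - l))), in_square_open, Hxy. }
    apply is_derive_ext_loc with (fun x => / (2 * PI * l) * RInt (dipole U V x y l) 0 (2 * PI)).
    { revert L. apply filter_imp. intros s Hs. symmetry. apply Hmv, Hs. }
    apply is_derive_scal.
    apply (is_derive_RInt_smooth_param (fun x => dipole U V x y l) (fun x => dipole p q x y l)).
    + revert L. apply filter_imp. intros s Hs t.
      destruct (HUV _ _ (Hcirc _ _ Hs t)) as [DU DV].
      assert (Dc : is_derive (fun x => x + l * cos t) s 1) by (auto_derive; [trivial|ring]).
      assert (Ds : is_derive (fun x => y + l * sin t) s 0) by (auto_derive; [trivial|ring]).
      pose proof (is_derive_comp_2d U _ _ _ _ _ _ _ DU Dc Ds) as EU.
      pose proof (is_derive_comp_2d V _ _ _ _ _ _ _ DV Dc Ds) as EV.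
      unfold dipole. evar_last.
      * apply (is_derive_dot _ _ (fun _ => cos t) (fun _ => sin t) s _ _ 0 0 EU EV);
          apply is_derive_Reals, derivable_pt_lim_const.
      * ring.
    + intros t. unfold dipole.
      assert (Cx : continuity_2d_pt (fun x t => x + l * cos t) x t)
        by (apply continuity_2d_pt_plus_mult; [apply continuity_2d_pt_id1|
          apply continuity_2d_pt_const|apply continuity_2d_pt_cos]).
      assert (Cy : continuity_2d_pt (fun _ t => y + l * sin t) x t)
        by (apply continuity_2d_pt_plus_mult; [apply continuity_2d_pt_const|
          apply continuity_2d_pt_const|apply continuity_2d_pt_sin]).
      apply continuity_2d_pt_plus; apply continuity_2d_pt_mult;
        [|apply continuity_2d_pt_cos| |apply continuity_2d_pt_sin].
      * apply (continuity_2d_comp p (fun x t => x + l * cos t) (fun _ t => y + l * sin t)); auto.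
      * apply (continuity_2d_comp q (fun x t => x + l * cos t) (fun _ t => y + l * sin t)); auto.
    + revert L. apply filter_imp. intros s Hs. apply Hdip, Hs.
  - assert (L : locally y (fun y => in_square x0 y0 (r - l) x y)).
    { apply (locally_2d_1d_const_x (in_square x0 y0 (r - l))), in_square_open, Hxy. }
    apply is_derive_ext_loc with (fun y => / (2 * PI * l) * RInt (dipole U V x y l) 0 (2 * PI)).
    { revert L. apply filter_imp. intros s Hs. symmetry. apply Hmv, Hs. }
    apply is_derive_scal.
    apply (is_derive_RInt_smooth_param (fun y => dipole U V x y l)
      (fun y => dipole (fun x y => - q x y) p x y l)).
    + revert L. apply filter_imp. intros s Hs t.
      destruct (HUV _ _ (Hcirc _ _ Hs t)) as [DU DV].
      assert (Dc : is_derive (fun y => x + l * cos t) s 0) by (auto_derive; [trivial|ring]).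
      assert (Ds : is_derive (fun y => y + l * sin t) s 1) by (auto_derive; [trivial|ring]).
      pose proof (is_derive_comp_2d U _ _ _ _ _ _ _ DU Dc Ds) as EU.
      pose proof (is_derive_comp_2d V _ _ _ _ _ _ _ DV Dc Ds) as EV.
      unfold dipole. evar_last.
      * apply (is_derive_dot _ _ (fun _ => cos t) (fun _ => sin t) s _ _ 0 0 EU EV);
          apply is_derive_Reals, derivable_pt_lim_const.
      * ring.
    + intros t. unfold dipole.
      assert (Cx : continuity_2d_pt (fun _ t => x + l * cos t) y t)
        by (apply continuity_2d_pt_plus_mult; [apply continuity_2d_pt_const|
          apply continuity_2d_pt_const|apply continuity_2d_pt_cos]).
      assert (Cy : continuity_2d_pt (fun y t => y + l * sin t) y t)
        by (apply continuity_2d_pt_plus_mult; [apply continuity_2d_pt_id1|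
          apply continuity_2d_pt_const|apply continuity_2d_pt_sin]).
      apply continuity_2d_pt_plus; apply continuity_2d_pt_mult;
        [apply continuity_2d_pt_opp|apply continuity_2d_pt_cos| |apply continuity_2d_pt_sin].
      * apply (continuity_2d_comp q (fun _ t => x + l * cos t) (fun y t => y + l * sin t)); auto.
      * apply (continuity_2d_comp p (fun _ t => x + l * cos t) (fun y t => y + l * sin t)); auto.
    + revert L. apply filter_imp. intros s Hs. apply Hdip, Hs.
Qed.

Lemma differentiable_of_partials (f fx : R -> R -> R) (x y fy : R) :
  locally_2d (fun u v => is_derive (fun z => f z v) u (fx u v)) x y ->
  continuity_2d_pt fx x y -> is_derive (fun z => f x z) y fy ->
  differentiable_pt_lim f x y (fx x y) fy.
Proof.
  intros Hx Hc Hy. apply filterdiff_differentiable_pt_lim.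
  apply (is_derive_filterdiff f x y fx fy).
  - apply (locally_2d_locally (fun u v => is_derive (fun z => f z v) u (fx u v))), Hx.
  - exact Hy.
  - apply continuity_2d_pt_filterlim, Hc.
Qed.

Lemma differentiable_pt_lim_opp (f : R -> R -> R) (x y lx ly : R) :
  differentiable_pt_lim f x y lx ly ->
  differentiable_pt_lim (fun u v => - f u v) x y (- lx) (- ly).
Proof.
  intros H eps. generalize (H eps). apply locally_2d_impl, locally_2d_forall.
  intros u v Huv. rewrite <- Rabs_Ropp. eapply Rle_trans; [|exact Huv].
  apply Req_le. f_equal. ring.
Qed.

(** The continuous derivative [p + i q] of a holomorphic function is holomorphic, again with
    continuous derivative.  Applying the mean value formula to [U + i V] gives the partial
    derivatives of [p], applying it to [- i (U + i V) = V - i U] gives those of [q]. *)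
Lemma CR_derivative_regular (U V p q : R -> R -> R) (x0 y0 r : R) :
  CR_on_square x0 y0 r U V p q ->
  continuous_on_square x0 y0 r p -> continuous_on_square x0 y0 r q ->
  0 < r -> exists a b : R -> R -> R,
  CR_on_square x0 y0 (r / 2) p q a b /\
  continuous_on_square x0 y0 (r / 2) a /\ continuous_on_square x0 y0 (r / 2) b.
Proof.
  intros HUV Hp Hq Hr.
  assert (HVU : CR_on_square x0 y0 r V (fun x y => - U x y) q (fun x y => - p x y)).
  { intros x y Hxy. destruct (HUV x y Hxy) as [DU DV]. split.
    - rewrite Ropp_involutive. exact DV.
    - apply differentiable_pt_lim_opp in DU. rewrite Ropp_involutive in DU. exact DU. }
  assert (Hp' : continuous_on_square x0 y0 r (fun x y => - p x y)).
  { intros x y Hxy. apply continuity_2d_pt_opp, Hp, Hxy. }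
  assert (Hl : 0 < r / 2) by lra.
  pose proof (mean_value_derive U V p q x0 y0 r (r / 2) HUV Hp Hq Hl) as Dp.
  pose proof (mean_value_derive V (fun x y => - U x y) q (fun x y => - p x y) x0 y0 r (r / 2)
                HVU Hq Hp' Hl) as Dq.
  pose proof (dipole_RInt_continuous p q x0 y0 r (r / 2) Hp Hq Hl) as Ca.
  pose proof (dipole_RInt_continuous q (fun x y => - p x y) x0 y0 r (r / 2) Hq Hp' Hl) as Cb.
  assert (Eopp : forall x y, in_square x0 y0 (r - r / 2) x y ->
     RInt (dipole (fun x y => - q x y) p x y (r / 2)) 0 (2 * PI) =
     - RInt (dipole q (fun x y => - p x y) x y (r / 2)) 0 (2 * PI)).
  { intros x y Hxy. destruct (in_square_room _ _ _ _ _ _ Hl Hxy).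
    rewrite <- (RInt_opp (V := R_CompleteNormedModule));
      [|apply (ex_RInt_dipole q (fun x y => - p x y) x0 y0 r); assumption].
    apply RInt_ext. intros t _. unfold dipole, opp; simpl. ring. }
  replace (r - r / 2) with (r / 2) in Dp, Dq, Ca, Cb, Eopp by field.
  pose (a x y := / (2 * PI * (r / 2)) * RInt (dipole p q x y (r / 2)) 0 (2 * PI)).
  pose (b x y := / (2 * PI * (r / 2)) * RInt (dipole q (fun x y => - p x y) x y (r / 2)) 0 (2 * PI)).
  assert (Ca' : continuous_on_square x0 y0 (r / 2) a).
  { intros x y Hxy. apply continuity_2d_pt_mult; [apply continuity_2d_pt_const|apply Ca, Hxy]. }
  assert (Cb' : continuous_on_square x0 y0 (r / 2) b).
  { intros x y Hxy. apply continuity_2d_pt_mult; [apply continuity_2d_pt_const|apply Cb, Hxy]. }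
  exists a, b. split; [|split; assumption]. intros x y Hxy. split.
  - apply differentiable_of_partials; [|auto|].
    + generalize (in_square_open _ _ _ _ _ Hxy). apply locally_2d_impl, locally_2d_forall.
      intros u v Huv. exact (proj1 (Dp u v Huv)).
    + destruct (Dp x y Hxy) as [_ E]. evar_last; [exact E|].
      rewrite Eopp by exact Hxy. unfold b. ring.
  - apply differentiable_of_partials; [|auto|].
    + generalize (in_square_open _ _ _ _ _ Hxy). apply locally_2d_impl, locally_2d_forall.
      intros u v Huv. exact (proj1 (Dq u v Huv)).
    + destruct (Dq x y Hxy) as [_ E]. evar_last; [exact E|]. unfold a. f_equal.
      apply RInt_ext. intros t _. unfold dipole; simpl. ring.
Qed.

(** * Calculus of complex derivatives *)

Notation is_C_derive := (is_derive (K := C_AbsRing) (V := C_NormedModule)).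

Lemma is_C_derive_eps (f : C -> C) (z l : C) :
  (forall eps, 0 < eps -> exists delta, 0 < delta /\ forall w, Cmod (w - z) < delta ->
     Cmod (f w - f z - (w - z) * l) <= eps * Cmod (w - z)) ->
  is_C_derive f z l.
Proof.
  intros H. split.
  { apply (is_linear_scal_l (K := C_AbsRing) (V := C_NormedModule) l). }
  intros z' Hz'.
  assert (z = z') as <-.
  { apply (is_filter_lim_locally_unique (K := C_AbsRing) (V := AbsRing_NormedModule C_AbsRing)).
    exact Hz'. }
  intros eps. destruct (H eps (cond_pos eps)) as (d & Hd & Hw).
  exists (mkposreal _ Hd). intros w Hwz. apply Hw, Hwz.
Qed.

Lemma is_C_derive_const (c z : C) : is_C_derive (fun _ => c) z (RtoC 0).
Proof. exact (is_derive_const (K := C_AbsRing) (V := C_NormedModule) c z). Qed.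

Lemma is_C_derive_plus (f g : C -> C) (z f' g' : C) :
  is_C_derive f z f' -> is_C_derive g z g' -> is_C_derive (fun w => (f w + g w)%C) z (f' + g')%C.
Proof. intros Hf Hg. exact (is_derive_plus (K := C_AbsRing) (V := C_NormedModule) f g z f' g' Hf Hg). Qed.

Lemma is_C_derive_minus (f g : C -> C) (z f' g' : C) :
  is_C_derive f z f' -> is_C_derive g z g' -> is_C_derive (fun w => (f w - g w)%C) z (f' - g')%C.
Proof. intros Hf Hg. exact (is_derive_minus (K := C_AbsRing) (V := C_NormedModule) f g z f' g' Hf Hg). Qed.

Lemma is_C_derive_opp (f : C -> C) (z f' : C) :
  is_C_derive f z f' -> is_C_derive (fun w => (- f w)%C) z (- f')%C.
Proof. intros Hf. exact (is_derive_opp (K := C_AbsRing) (V := C_NormedModule) f z f' Hf). Qed.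

(** The complex numbers carry two structures of normed space over themselves, with the same norm; the
    product and chain rules are available for one, derivatives are meant in the other. *)
Lemma is_derive_AbsRing_iff (f : C -> C) (z l : C) :
  is_derive (K := C_AbsRing) (V := AbsRing_NormedModule C_AbsRing) f z l <-> is_C_derive f z l.
Proof.
  split; intros [_ H]; split; try exact H.
  - apply (is_linear_scal_l (K := C_AbsRing) (V := C_NormedModule) l).
  - apply (is_linear_scal_l (K := C_AbsRing) (V := AbsRing_NormedModule C_AbsRing) l).
Qed.

Lemma is_C_derive_mult (f g : C -> C) (z f' g' : C) :
  is_C_derive f z f' -> is_C_derive g z g' ->
  is_C_derive (fun w => (f w * g w)%C) z (f' * g z + f z * g')%C.
Proof.
  rewrite <- !is_derive_AbsRing_iff. intros Hf Hg.
  exact (is_derive_mult (K := C_AbsRing) f g z f' g' Hf Hg Cmult_comm).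
Qed.

Lemma is_C_derive_scal (c : C) (f : C -> C) (z f' : C) :
  is_C_derive f z f' -> is_C_derive (fun w => (c * f w)%C) z (c * f')%C.
Proof.
  intros Hf. replace (c * f')%C with (RtoC 0 * f z + c * f')%C by ring.
  apply (is_C_derive_mult (fun _ => c)); [apply is_C_derive_const|exact Hf].
Qed.

Lemma is_C_derive_comp (f g : C -> C) (z f' g' : C) :
  is_C_derive f (g z) f' -> is_C_derive g z g' -> is_C_derive (fun w => f (g w)) z (g' * f')%C.
Proof.
  rewrite <- (is_derive_AbsRing_iff g). intros Hf Hg.
  exact (is_derive_comp (K := C_AbsRing) (V := C_NormedModule) f g z f' g' Hf Hg).
Qed.

Lemma is_C_derive_ext_loc (f g : C -> C) (z l : C) :
  locally_2d (fun u v => f (u, v) = g (u, v)) (fst z) (snd z) ->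
  is_C_derive f z l -> is_C_derive g z l.
Proof.
  intros H. apply (is_derive_ext_loc (K := C_AbsRing) (V := C_NormedModule)).
  apply (locally_C_2d z (fun w => f w = g w)), H.
Qed.

(** A first order expansion with quadratic error term gives the derivative; the inverse and the square
    root are treated in this way. *)
Lemma is_C_derive_quadratic (f : C -> C) (z l : C) (M d : R) :
  0 < d ->
  (forall w, Cmod (w - z) < d -> Cmod (f w - f z - (w - z) * l) <= M * Cmod (w - z) ^ 2) ->
  is_C_derive f z l.
Proof.
  intros Hd H. apply is_C_derive_eps. intros eps He.
  pose (M' := Rmax M 1).
  assert (HM : 0 < M') by (unfold M'; pose proof (Rmax_r M 1); lra).
  exists (Rmin d (eps / M')). split.
  { apply Rmin_glb_lt; [exact Hd|]. apply Rdiv_lt_0_compat; assumption. }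
  intros w Hw. pose proof (Rmin_l d (eps / M')). pose proof (Rmin_r d (eps / M')).
  eapply Rle_trans; [apply H; lra|].
  pose proof (Cmod_ge_0 (w - z)). set (k := Cmod _) in *.
  assert (Hk : k * M' <= eps).
  { apply Rle_trans with (eps / M' * M'); [apply Rmult_le_compat_r; lra|right; field; lra]. }
  assert (HMM : M <= M') by apply Rmax_l.
  apply Rle_trans with (M' * k ^ 2); [apply Rmult_le_compat_r; [apply pow2_ge_0|exact HMM]|].
  nra.
Qed.

Lemma Cmod_minus_swap (a b : C) : Cmod (a - b) = Cmod (b - a).
Proof. rewrite <- Cmod_opp. f_equal. ring. Qed.

Lemma is_C_derive_Cinv (w : C) : w <> RtoC 0 -> is_C_derive Cinv w (- / (w * w))%C.
Proof.
  intros Hw. assert (Hm := proj1 (Cmod_gt_0 w) Hw).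
  apply (is_C_derive_quadratic _ _ _ (2 / Cmod w ^ 3) (Cmod w / 2)); [lra|].
  intros u Hu.
  assert (Hmu : Cmod w / 2 <= Cmod u).
  { pose proof (Cmod_triangle u (w - u)) as T. replace (u + (w - u))%C with w in T by ring.
    rewrite Cmod_minus_swap in T. lra. }
  assert (Hu0 : u <> RtoC 0) by (apply Cmod_gt_0; lra).
  (* the error of the first order expansion of the inverse is (u - w)^2 / (u w^2) *)
  replace (/ u - / w - (u - w) * - / (w * w))%C with ((u - w) * (u - w) / (u * (w * w)))%C
    by (field; split; assumption).
  rewrite Cmod_div by (repeat apply Cmult_neq_0; assumption).
  rewrite !Cmod_mult. set (k := Cmod (u - w)).
  assert (0 <= k) by apply Cmod_ge_0.
  apply Rle_trans with (k * k / (Cmod w / 2 * (Cmod w * Cmod w))); [|right; field; lra].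
  apply Rmult_le_compat_l; [nra|]. apply Rinv_le_contravar; [repeat apply Rmult_lt_0_compat; lra|].
  apply Rmult_le_compat_r; nra.
Qed.

Lemma is_C_derive_inv (f : C -> C) (z f' : C) :
  is_C_derive f z f' -> f z <> RtoC 0 ->
  is_C_derive (fun w => (/ f w)%C) z (f' * - / (f z * f z))%C.
Proof. intros Hf H0. apply is_C_derive_comp; [apply is_C_derive_Cinv, H0|exact Hf]. Qed.

Lemma holomorphic_is_derive (D : C -> Prop) (f : C -> C) (z : C) :
  holomorphic D f -> D z -> is_C_derive f z (C_derive f z).
Proof. intros Hf Hz. apply (C_derive_correct f z z), Hf, Hz. Qed.

Lemma holomorphic_intro (D : C -> Prop) (f f' : C -> C) :
  (forall z, D z -> is_C_derive f z (f' z)) -> holomorphic D f.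
Proof. intros H z Hz. exists (f' z). apply H, Hz. Qed.

Lemma is_C_derive_inj (f : C -> C) (z l l' : C) :
  is_C_derive f z l -> is_C_derive f z l' -> l = l'.
Proof.
  intros H H'. rewrite <- (is_C_derive_unique f z l H). apply (is_C_derive_unique f z l' H').
Qed.

Lemma Cminus_eq_0 (a b : C) : (a - b)%C = RtoC 0 -> a = b.
Proof. intros H. replace a with (a - b + b)%C by ring. rewrite H. ring. Qed.

Lemma is_C_derive_neq (f : C -> C) (z l : C) :
  is_C_derive f z l -> l <> RtoC 0 ->
  locally_2d (fun u v => (u, v) <> z -> f (u, v) <> f z) (fst z) (snd z).
Proof.
  intros [_ H] Hl. specialize (H z (fun P h => h)).
  assert (Hm := proj1 (Cmod_gt_0 l) Hl).
  assert (He : 0 < Cmod l / 2) by lra.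
  specialize (H (mkposreal _ He)). apply locally_C_2d in H. revert H.
  apply locally_2d_impl, locally_2d_forall. intros u v H Huv E.
  change (Cmod ((f (u, v) - f z) - ((u, v) - z) * l) <= Cmod l / 2 * Cmod ((u, v) - z)) in H.
  rewrite E in H. replace (f z - f z - ((u, v) - z) * l)%C with (- (((u, v) - z) * l))%C in H by ring.
  rewrite Cmod_opp, Cmod_mult in H.
  assert (Hd : 0 < Cmod ((u, v) - z)).
  { apply Cmod_gt_0. intros E'. exact (Huv (Cminus_eq_0 _ _ E')). }
  nra.
Qed.

Lemma is_C_derive_continuous (f : C -> C) (z l : C) (eps : R) :
  is_C_derive f z l -> 0 < eps ->
  locally_2d (fun u v => Cmod (f (u, v) - f z) < eps) (fst z) (snd z).
Proof.
  intros Hf He. apply is_derive_C_iff in Hf. destruct Hf as [Hp Hq].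
  apply differentiable_continuity in Hp. apply differentiable_continuity in Hq.
  assert (He' : 0 < eps / 2) by lra.
  generalize (locally_2d_and _ _ _ _ (Hp (mkposreal _ He')) (Hq (mkposreal _ He'))).
  apply locally_2d_impl, locally_2d_forall. intros u v [H1 H2]. simpl in H1, H2.
  destruct z as [z1 z2]; simpl in *.
  eapply Rle_lt_trans; [apply Cmod_2Rmax|].
  assert (Rmax (Rabs (fst (f (u, v) - f (z1, z2))%C)) (Rabs (snd (f (u, v) - f (z1, z2))%C)) < eps / 2).
  { apply Rmax_lub_lt; assumption. }
  assert (S2 : sqrt 2 < 2).
  { rewrite <- (sqrt_Rsqr 2) at 2 by lra. apply sqrt_lt_1; unfold Rsqr; lra. }
  pose proof Rlt_sqrt2_0.
  assert (0 <= Rmax (Rabs (fst (f (u, v) - f (z1, z2))%C)) (Rabs (snd (f (u, v) - f (z1, z2))%C))).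
  { eapply Rle_trans; [apply Rabs_pos|apply Rmax_l]. }
  nra.
Qed.

Lemma is_C_derive_nonzero (f : C -> C) (z l : C) :
  is_C_derive f z l -> f z <> RtoC 0 ->
  locally_2d (fun u v => f (u, v) <> RtoC 0) (fst z) (snd z).
Proof.
  intros Hf H0. assert (Hm := proj1 (Cmod_gt_0 _) H0).
  generalize (is_C_derive_continuous f z l _ Hf Hm).
  apply locally_2d_impl, locally_2d_forall. intros u v H E. rewrite E in H.
  replace (RtoC 0 - f z)%C with (- f z)%C in H by ring. rewrite Cmod_opp in H. lra.
Qed.

(** * Open sets and squares *)

Definition square (c : C) (r : R) : C -> Prop := fun z => in_square (fst c) (snd c) r (fst z) (snd z).

Lemma open_locally_2d (D : C -> Prop) (z : C) :
  open D -> D z -> locally_2d (fun u v => D (u, v)) (fst z) (snd z).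
Proof.
  intros HD Hz. apply locally_C_2d, locally_C. apply HD, Hz.
Qed.

Lemma open_square_inside (D : C -> Prop) (z : C) :
  open D -> D z -> exists r, 0 < r /\ subdomain (square z r) D.
Proof.
  intros HD Hz. destruct (open_locally_2d D z HD Hz) as [d Hd].
  exists d. split; [apply cond_pos|]. intros [u v] [Hu Hv]. apply Hd; assumption.
Qed.

Lemma locally_2d_square (P : C -> Prop) (z : C) :
  locally_2d (fun u v => P (u, v)) (fst z) (snd z) -> exists r, 0 < r /\ subdomain (square z r) P.
Proof.
  intros [d Hd].
  exists d. split; [apply cond_pos|]. intros [u v] [Hu Hv]. apply Hd; assumption.
Qed.

Lemma square_center (c : C) (r : R) : 0 < r -> square c r c.
Proof. intros Hr. split; rewrite Rminus_diag, Rabs_R0; exact Hr. Qed.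

Lemma open_of_locally_2d (D : C -> Prop) :
  (forall z, D z -> locally_2d (fun u v => D (u, v)) (fst z) (snd z)) -> open D.
Proof. intros H z Hz. apply locally_C, locally_C_2d, H, Hz. Qed.

Lemma square_open (c : C) (r : R) : open (square c r).
Proof.
  apply open_of_locally_2d. intros z Hz. apply in_square_open in Hz. exact Hz.
Qed.

(** On a segment joining a point of [A] to a point of [B], the supremum of the parameters of points in
    [A] is the parameter of a point near which both sets are met. *)
Lemma square_domain (c : C) (r : R) : 0 < r -> complex_domain (square c r).
Proof.
  intros Hr. split; [apply square_open|]. split; [exists c; apply square_center, Hr|].
  intros A B HA HB Hcover (a & HaS & HaA) (b & HbS & HbB).
  pose (g t := (fst a + t * (fst b - fst a), snd a + t * (snd b - snd a)) : C).
  assert (Hg : forall t, 0 <= t <= 1 -> square c r (g t)).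
  { intros t Ht. destruct HaS as [Ha1 Ha2], HbS as [Hb1 Hb2].
    apply Rabs_lt_between in Ha1, Ha2, Hb1, Hb2. split; simpl; apply Rabs_lt_between.
    - destruct (Rle_dec (fst a) (fst b)); nra.
    - destruct (Rle_dec (snd a) (snd b)); nra. }
  assert (g0 : g 0 = a) by (unfold g; destruct a; simpl; f_equal; ring).
  assert (g1 : g 1 = b) by (unfold g; destruct a, b; simpl; f_equal; ring).
  assert (Hopen : forall O, open O -> forall t, O (g t) ->
    exists d : posreal, forall s, Rabs (s - t) < d -> O (g s)).
  { intros O HO t Ht. destruct (open_locally_2d O (g t) HO Ht) as [d Hd]. simpl in Hd.
    set (M := Rabs (fst b - fst a) + Rabs (snd b - snd a) + 1).
    pose proof (Rabs_pos (fst b - fst a)). pose proof (Rabs_pos (snd b - snd a)).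
    assert (HM : 0 < M) by (unfold M; lra).
    assert (Hdm : 0 < d / M) by (apply Rdiv_lt_0_compat; [apply cond_pos|exact HM]).
    exists (mkposreal _ Hdm). simpl. intros s Hs.
    assert (HsM : Rabs (s - t) * M < d).
    { apply Rmult_lt_compat_r with (r := M) in Hs; [|exact HM].
      replace (d / M * M) with (pos d) in Hs by (field; lra). exact Hs. }
    pose proof (Rabs_pos (s - t)).
    apply Hd.
    - replace (fst a + s * (fst b - fst a) - (fst a + t * (fst b - fst a))) with
        ((s - t) * (fst b - fst a)) by ring.
      rewrite Rabs_mult. unfold M in HsM. nra.
    - replace (snd a + s * (snd b - snd a) - (snd a + t * (snd b - snd a))) with
        ((s - t) * (snd b - snd a)) by ring.
      rewrite Rabs_mult. unfold M in HsM. nra. }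
  destruct (completeness (fun t => 0 <= t <= 1 /\ A (g t))) as [s [Hub Hlub]].
  { exists 1. intros t [Ht _]. apply Ht. }
  { exists 0. split; [lra|]. rewrite g0. exact HaA. }
  assert (Hs : 0 <= s <= 1).
  { split.
    - apply Hub. split; [lra|]. rewrite g0. exact HaA.
    - apply Hlub. intros t [Ht _]. apply Ht. }
  destruct (Hcover (g s) (Hg s Hs)) as [HsA|HsB].
  - destruct (Req_dec s 1) as [->|Hs1].
    + exists b. rewrite g1 in HsA. auto.
    + exfalso. destruct (Hopen A HA s HsA) as [d Hd]. pose proof (cond_pos d).
      pose (s' := s + Rmin (d / 2) (1 - s)).
      assert (0 < Rmin (d / 2) (1 - s)) by (apply Rmin_glb_lt; lra).
      pose proof (Rmin_l (d / 2) (1 - s)). pose proof (Rmin_r (d / 2) (1 - s)).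
      assert (s' <= s); [|unfold s' in *; lra].
      apply Hub. split; [unfold s'; lra|]. apply Hd. apply Rabs_lt_between. unfold s'; lra.
  - destruct (Hopen B HB s HsB) as [d Hd]. pose proof (cond_pos d).
    apply NNPP. intros Hno.
    assert (s <= s - d); [|lra].
    apply Hlub. intros t [Ht HtA].
    destruct (Rle_dec t (s - d)) as [|Hn]; [assumption|exfalso].
    apply Hno. exists (g t). split; [apply Hg, Ht|]. split; [exact HtA|].
    apply Hd. assert (t <= s) by (apply Hub; split; assumption). apply Rabs_lt_between. lra.
Qed.

(** * Holomorphic functions: derivatives, primitives, real parts *)

Lemma in_square_shrink (x0 y0 r r' x y : R) :
  r' <= r -> in_square x0 y0 r' x y -> in_square x0 y0 r x y.
Proof. intros Hr [Hx Hy]. split; lra. Qed.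

(** [f dz = (p dx - q dy) + i (q dx + p dy)] is closed by the Cauchy-Riemann equations. *)
Lemma CR_primitive (p q a b : R -> R -> R) (x0 y0 r : R) :
  CR_on_square x0 y0 r p q a b -> exists U V, CR_on_square x0 y0 r U V p q.
Proof.
  intros H.
  destruct (potential p (fun x y => - q x y) x0 y0 r) as [U HU].
  { intros x y Hxy. destruct (H x y Hxy) as [Hp Hq].
    exists (- b x y), (a x y), (- a x y). split; [exact Hp|].
    apply differentiable_pt_lim_opp, Hq. }
  destruct (potential q p x0 y0 r) as [V HV].
  { intros x y Hxy. destruct (H x y Hxy) as [Hp Hq].
    exists (a x y), (b x y), (- b x y). split; assumption. }
  exists U, V. intros x y Hxy. split; [apply HU, Hxy|apply HV, Hxy].
Qed.

Lemma CR_differentiable_unique (p q : R -> R -> R) (x y a b a' b' : R) :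
  CR_differentiable p q x y a b -> CR_differentiable p q x y a' b' -> a = a' /\ b = b'.
Proof.
  intros [Hp Hq] [Hp' Hq'].
  apply differentiable_pt_lim_unique in Hq, Hq'. destruct Hq as [<- <-], Hq' as [<- <-]. auto.
Qed.

(** [p + i q] has a primitive [U + i V] with continuous derivative, so its own derivative [a + i b] is
    continuous; the same regularity step, now applied to [p + i q] and [a + i b], makes [a + i b]
    differentiable. *)
Lemma CR_derivative_CR (p q a b : R -> R -> R) (x0 y0 r : R) :
  0 < r -> CR_on_square x0 y0 r p q a b ->
  exists a' b', CR_differentiable a b x0 y0 a' b'.
Proof.
  intros Hr H.
  destruct (CR_on_square_continuous _ _ _ _ _ _ _ H) as [Hp Hq].
  destruct (CR_primitive p q a b x0 y0 r H) as (U & V & HUV).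
  destruct (CR_derivative_regular U V p q x0 y0 r HUV Hp Hq Hr) as (a1 & b1 & H1 & Ca1 & Cb1).
  assert (Hr2 : r / 2 <= r) by lra.
  assert (H2 : CR_on_square x0 y0 (r / 2) p q a b).
  { intros x y Hxy. apply H. eapply in_square_shrink; eassumption. }
  assert (E : forall x y, in_square x0 y0 (r / 2) x y -> a1 x y = a x y /\ b1 x y = b x y).
  { intros x y Hxy. eapply CR_differentiable_unique; [apply H1, Hxy|apply H2, Hxy]. }
  assert (L : forall x y, in_square x0 y0 (r / 2) x y ->
    locally_2d (fun u v => a1 u v = a u v /\ b1 u v = b u v) x y).
  { intros x y Hxy. generalize (in_square_open _ _ _ _ _ Hxy).
    apply locally_2d_impl, locally_2d_forall. exact E. }
  destruct (CR_derivative_regular p q a b x0 y0 (r / 2) H2) as (a2 & b2 & H3 & _).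
  - intros x y Hxy. eapply continuity_2d_pt_ext_loc; [|apply Ca1, Hxy].
    generalize (L x y Hxy). apply locally_2d_impl, locally_2d_forall. intros u v Huv. apply Huv.
  - intros x y Hxy. eapply continuity_2d_pt_ext_loc; [|apply Cb1, Hxy].
    generalize (L x y Hxy). apply locally_2d_impl, locally_2d_forall. intros u v Huv. apply Huv.
  - lra.
  - exists (a2 x0 y0), (b2 x0 y0). apply H3. split; rewrite Rminus_diag, Rabs_R0; lra.
Qed.

Lemma holomorphic_CR (D : C -> Prop) (f : C -> C) (x y : R) :
  holomorphic D f -> D (x, y) ->
  CR_differentiable (fun u v => fst (f (u, v))) (fun u v => snd (f (u, v))) x y
    (fst (C_derive f (x, y))) (snd (C_derive f (x, y))).
Proof.
  intros Hf Hz. pose proof (holomorphic_is_derive D f (x, y) Hf Hz) as H.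
  apply is_derive_C_iff in H. exact H.
Qed.

Theorem holomorphic_derive (D : C -> Prop) (f : C -> C) :
  open D -> holomorphic D f -> holomorphic D (C_derive f).
Proof.
  intros HD Hf z Hz.
  destruct (open_square_inside D z HD Hz) as (r & Hr & HS).
  destruct (CR_derivative_CR (fun u v => fst (f (u, v))) (fun u v => snd (f (u, v)))
    (fun u v => fst (C_derive f (u, v))) (fun u v => snd (C_derive f (u, v))) (fst z) (snd z) r Hr)
    as (a & b & Hab).
  - intros x y Hxy. apply (holomorphic_CR D); [exact Hf|]. apply HS. exact Hxy.
  - exists (a, b). apply is_derive_C_iff. exact Hab.
Qed.

Theorem holomorphic_local_primitive (f : C -> C) (c : C) (r : R) :
  holomorphic (square c r) f ->
  exists F, forall z, square c r z -> is_C_derive F z (f z).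
Proof.
  intros Hf.
  destruct (CR_primitive (fun u v => fst (f (u, v))) (fun u v => snd (f (u, v)))
    (fun u v => fst (C_derive f (u, v))) (fun u v => snd (C_derive f (u, v))) (fst c) (snd c) r)
    as (U & V & HUV).
  - intros x y Hxy. apply (holomorphic_CR (square c r)); assumption.
  - exists (fun z => (U (fst z) (snd z), V (fst z) (snd z)) : C). intros z Hz.
    apply is_derive_C_iff. destruct z as [x y]. apply HUV, Hz.
Qed.

Lemma is_derive_differentiable_u (f : R -> R -> R) (x y lx ly : R) :
  differentiable_pt_lim f x y lx ly -> is_derive (fun s => f s y) x lx.
Proof.
  intros H. evar_last.
  - apply (is_derive_comp_2d f (fun s => s) (fun _ => y) x lx ly 1 0 H);
    apply is_derive_Reals; [apply derivable_pt_lim_id|apply derivable_pt_lim_const].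
  - ring.
Qed.

Lemma is_derive_differentiable_v (f : R -> R -> R) (x y lx ly : R) :
  differentiable_pt_lim f x y lx ly -> is_derive (fun s => f x s) y ly.
Proof.
  intros H. evar_last.
  - apply (is_derive_comp_2d f (fun _ => x) (fun s => s) y lx ly 0 1 H);
    apply is_derive_Reals; [apply derivable_pt_lim_const|apply derivable_pt_lim_id].
  - ring.
Qed.

Lemma is_C_derive_partials_Re (f : C -> C) (z l : C) :
  is_C_derive f z l ->
  is_derive (fun r => Re (f (r, snd z))) (fst z) (Re l) /\
  is_derive (fun r => Re (f (fst z, r))) (snd z) (- Im l).
Proof.
  intros H. apply is_derive_C_iff in H. destruct H as [Hp _]. split.
  - exact (is_derive_differentiable_u _ _ _ _ _ Hp).
  - exact (is_derive_differentiable_v _ _ _ _ _ Hp).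
Qed.

Lemma pd_ext (D : C -> Prop) (f g : C -> R) :
  open D -> (forall z, D z -> f z = g z) ->
  forall z, D z -> pd_u f z = pd_u g z /\ pd_v f z = pd_v g z.
Proof.
  intros HD E z Hz. pose proof (open_locally_2d D z HD Hz) as L. split.
  - apply Derive_ext_loc. apply locally_2d_1d_const_y in L. revert L.
    apply filter_imp. intros r Hr. apply E, Hr.
  - apply Derive_ext_loc. apply locally_2d_1d_const_x in L. revert L.
    apply filter_imp. intros r Hr. apply E, Hr.
Qed.

Lemma Ck_ext (D : C -> Prop) (n : nat) (f g : C -> R) :
  open D -> (forall z, D z -> f z = g z) -> Ck n D f -> Ck n D g.
Proof.
  intros HD. revert f g. induction n as [|n IH]; intros f g E [Hc H]; split.
  - intros z Hz. apply (continuous_ext_loc (T := C_UniformSpace) (U := R_UniformSpace) g f z); [|apply Hc, Hz].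
    generalize (HD z Hz). apply filter_imp. exact E.
  - exact I.
  - intros z Hz. apply (continuous_ext_loc (T := C_UniformSpace) (U := R_UniformSpace) g f z); [|apply Hc, Hz].
    generalize (HD z Hz). apply filter_imp. exact E.
  - destruct H as (Hd & Hu & Hv). split; [|split].
    + intros z Hz. destruct (Hd z Hz) as [H1 H2]. pose proof (open_locally_2d D z HD Hz) as L. split.
      * eapply ex_derive_ext_loc; [|exact H1]. apply locally_2d_1d_const_y in L. revert L.
        apply filter_imp. intros r Hr. apply E, Hr.
      * eapply ex_derive_ext_loc; [|exact H2]. apply locally_2d_1d_const_x in L. revert L.
        apply filter_imp. intros r Hr. apply E, Hr.
    + apply IH with (2 := Hu). intros z Hz. apply (pd_ext D f g HD E z Hz).
    + apply IH with (2 := Hv). intros z Hz. apply (pd_ext D f g HD E z Hz).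
Qed.

(** The partial derivatives of [Re f] are [Re f'] and [Re (i f')], real parts of holomorphic functions
    again. *)
Theorem Ck_Re_holomorphic (D : C -> Prop) (n : nat) (f : C -> C) :
  open D -> holomorphic D f -> Ck n D (fun z => Re (f z)).
Proof.
  intros HD. revert f.
  assert (Hcont : forall f, holomorphic D f -> forall z, D z -> continuous (fun z => Re (f z)) z).
  { intros f Hf [x y] Hz.
    pose proof (proj1 (holomorphic_CR D f x y Hf Hz)) as H.
    apply differentiable_continuity, continuity_2d_pt_filterlim in H.
    eapply filterlim_ext; [|exact H]. intros [u v]. reflexivity. }
  induction n as [|n IH]; intros f Hf; split.
  - apply Hcont, Hf.
  - exact I.
  - apply Hcont, Hf.
  - assert (Hd : forall z, D z -> is_derive (fun r => Re (f (r, snd z))) (fst z) (Re (C_derive f z)) /\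
      is_derive (fun r => Re (f (fst z, r))) (snd z) (- Im (C_derive f z))).
    { intros z Hz. apply is_C_derive_partials_Re, (holomorphic_is_derive D); assumption. }
    pose proof (holomorphic_derive D f HD Hf) as Hf'.
    split; [|split].
    + intros z Hz. destruct (Hd z Hz). split; eexists; eassumption.
    + apply (Ck_ext D n (fun z => Re (C_derive f z))); [exact HD| |apply IH, Hf'].
      intros z Hz. symmetry. apply is_derive_unique, Hd, Hz.
    + apply (Ck_ext D n (fun z => Re (Ci * C_derive f z)%C)); [exact HD| |apply IH].
      * intros z Hz. transitivity (- Im (C_derive f z)).
        2: { symmetry. apply is_derive_unique, Hd, Hz. }
        destruct (C_derive f z) as [a b]. simpl. ring.
      * apply (holomorphic_intro D _ (fun z => Ci * C_derive (C_derive f) z)%C).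
        intros z Hz. apply is_C_derive_scal, (holomorphic_is_derive D); assumption.
Qed.

(** * Square roots *)

Lemma Ci_sqr : (Ci * Ci)%C = (- RtoC 1)%C.
Proof. apply injective_projections; simpl; ring. Qed.

(** Principal square root.  The formula is correct away from the closed negative real axis, that is,
    where [Cmod w + Re w] is positive. *)
Definition csqrt (w : C) : C :=
  let h := sqrt ((Cmod w + Re w) / 2) in (h, Im w / (2 * h)).

Lemma csqrt_sqr (w : C) : 0 < Cmod w + Re w -> (csqrt w * csqrt w)%C = w /\ 0 < Re (csqrt w).
Proof.
  intros Hw. unfold csqrt. set (h := sqrt _).
  assert (Hh : 0 < h) by (apply sqrt_lt_R0; lra).
  assert (Hh2 : h * h = (Cmod w + Re w) / 2) by (apply sqrt_sqrt; lra).
  split; [|exact Hh].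
  destruct w as [x y]; simpl in *.
  assert (M : Cmod (x, y) * Cmod (x, y) = x * x + y * y).
  { unfold Cmod; simpl. rewrite sqrt_sqrt; [ring|]. nra. }
  set (m := Cmod _) in *.
  apply injective_projections; simpl; [|field; lra].
  replace (h * h - y / (2 * h) * (y / (2 * h))) with (h * h - y * y / (4 * (h * h))) by (field; lra).
  rewrite Hh2. replace (y * y) with ((m - x) * (m + x)) by lra. field. lra.
Qed.

Lemma Re_le_Cmod (z : C) : Rabs (Re z) <= Cmod z.
Proof. eapply Rle_trans; [apply Rmax_l|apply Rmax_Cmod]. Qed.

Lemma slit_plane_open (w u : C) :
  Cmod (u - w) < (Cmod w + Re w) / 2 -> 0 < Cmod u + Re u.
Proof.
  intros H.
  pose proof (Re_le_Cmod (u - w)) as H1.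
  pose proof (Cmod_triangle u (w - u)) as H2. replace (u + (w - u))%C with w in H2 by ring.
  rewrite (Cmod_minus_swap w u) in H2.
  apply Rabs_le_between in H1.
  replace (Re (u - w)) with (Re u - Re w) in H1 by (destruct u, w; reflexivity). lra.
Qed.

Lemma is_C_derive_csqrt (w : C) :
  0 < Cmod w + Re w -> is_C_derive csqrt w (/ (2 * csqrt w))%C.
Proof.
  intros Hw. destruct (csqrt_sqr w Hw) as [Sw Pw].
  set (rho := Re (csqrt w)) in *.
  apply (is_C_derive_quadratic _ _ _ (/ (2 * rho ^ 3)) ((Cmod w + Re w) / 2)); [lra|].
  intros u Hu. apply slit_plane_open in Hu. destruct (csqrt_sqr u Hu) as [Su Pu].
  set (a := csqrt w) in *. set (b := csqrt u) in *.
  assert (Ha : rho <= Cmod a).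
  { eapply Rle_trans; [|apply Re_le_Cmod]. apply Rle_abs. }
  assert (Hab : rho <= Cmod (b + a)).
  { eapply Rle_trans; [|apply Re_le_Cmod]. eapply Rle_trans; [|apply Rle_abs].
    replace (Re (b + a)) with (Re b + rho) by (unfold rho; destruct a, b; reflexivity). lra. }
  assert (Ha0 : a <> RtoC 0) by (apply Cmod_gt_0; lra).
  assert (Hab0 : (b + a)%C <> RtoC 0) by (apply Cmod_gt_0; lra).
  assert (H2 : (RtoC 2 <> RtoC 0)) by (intros E; apply RtoC_inj in E; lra).
  (* u - w = b^2 - a^2 turns the error of the first order expansion into
     - (u - w)^2 / (2 a (b + a)^2); the real parts bound the denominator from below *)
  replace (b - a - (u - w) * / (2 * a))%C with
    (- ((u - w) * (u - w) / (RtoC 2 * a * ((b + a) * (b + a)))))%C.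
  2: { rewrite <- Su, <- Sw. field. split; assumption. }
  rewrite Cmod_opp, Cmod_div by (repeat apply Cmult_neq_0; assumption).
  rewrite !Cmod_mult. rewrite Cmod_R, (Rabs_pos_eq 2) by lra.
  set (k := Cmod (u - w)).
  assert (0 <= k) by apply Cmod_ge_0.
  apply Rle_trans with (k * k * / (2 * rho * (rho * rho))); [|right; field; lra].
  apply Rmult_le_compat_l; [nra|]. apply Rinv_le_contravar.
  - repeat apply Rmult_lt_0_compat; lra.
  - apply Rmult_le_compat; nra.
Qed.

Theorem local_sqrt_branch (D : C -> Prop) (h : C -> C) (c : C) :
  open D -> holomorphic D h -> D c -> h c <> RtoC 0 ->
  exists (r : R) (s : C -> C), 0 < r /\ subdomain (square c r) D /\ sqrt_branch (square c r) h s.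
Proof.
  intros HD Hh Hc H0.
  assert (K : forall k, holomorphic D k -> 0 < Cmod (k c) + Re (k c) ->
    exists r s, 0 < r /\ subdomain (square c r) D /\ sqrt_branch (square c r) k s).
  { intros k Hk Hkc.
    assert (Hpos : 0 < (Cmod (k c) + Re (k c)) / 2) by lra.
    pose proof (is_C_derive_continuous k c _ _ (holomorphic_is_derive D k c Hk Hc) Hpos) as L.
    destruct (locally_2d_square (fun z => D z /\ Cmod (k z - k c) < (Cmod (k c) + Re (k c)) / 2) c)
      as (r & Hr & HS).
    { apply (locally_2d_and (fun u v => D (u, v))); [|exact L].
      apply open_locally_2d; assumption. }
    exists r, (fun z => csqrt (k z)). split; [exact Hr|]. split; [|split].
    - intros z Hz. apply HS, Hz.
    - intros z Hz. destruct (HS z Hz) as [HDz Hkz]. eexists.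
      apply is_C_derive_comp; [apply is_C_derive_csqrt, (slit_plane_open (k c)), Hkz|].
      apply (holomorphic_is_derive D); assumption.
    - intros z Hz. destruct (HS z Hz) as [HDz Hkz]. apply csqrt_sqr, (slit_plane_open (k c)), Hkz. }
  destruct (Rlt_dec 0 (Cmod (h c) + Re (h c))) as [Hpos|Hneg].
  { apply K; assumption. }
  (* h c is a negative real number: take a root of -h and multiply by i *)
  destruct (K (fun z => - h z)%C) as (r & s & Hr & HrD & Hs & Hsh).
  - intros z Hz. eexists. apply is_C_derive_opp. apply (holomorphic_is_derive D); assumption.
  - rewrite Cmod_opp. apply Cmod_gt_0 in H0.
    replace (Re (- h c)) with (- Re (h c)) by (destruct (h c); reflexivity). lra.
  - exists r, (fun z => Ci * s z)%C. split; [exact Hr|]. split; [exact HrD|]. split.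
    + intros z Hz. eexists. apply is_C_derive_scal. apply (holomorphic_is_derive (square c r)); assumption.
    + intros z Hz. replace (Ci * s z * (Ci * s z))%C with (Ci * Ci * (s z * s z))%C by ring.
      rewrite Hsh by exact Hz. rewrite Ci_sqr. ring.
Qed.

(** * Surfaces in isothermal parameters *)

Definition has_partials (f : C -> R) (t : C) : Prop :=
  is_derive (fun r => f (r, snd t)) (fst t) (pd_u f t) /\
  is_derive (fun r => f (fst t, r)) (snd t) (pd_v f t).

Lemma Ck_partials (n : nat) (D : C -> Prop) (f : C -> R) (t : C) :
  Ck (S n) D f -> D t -> has_partials f t.
Proof.
  intros (_ & Hd & _) Ht. destruct (Hd t Ht). split; apply Derive_correct; assumption.
Qed.

Lemma Ck_continuity_2d (n : nat) (D : C -> Prop) (f : C -> R) (t : C) :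
  Ck n D f -> D t -> continuity_2d_pt (fun u v => f (u, v)) (fst t) (snd t).
Proof.
  intros H Ht. assert (Hc : continuous f t) by (destruct n; apply H, Ht).
  apply continuity_2d_pt_filterlim. destruct t as [u v].
  eapply filterlim_ext; [|exact Hc]. intros [a b]. reflexivity.
Qed.

Lemma Ck_differentiable (n : nat) (D : C -> Prop) (f : C -> R) (t : C) :
  open D -> Ck (S n) D f -> D t ->
  differentiable_pt_lim (fun u v => f (u, v)) (fst t) (snd t) (pd_u f t) (pd_v f t).
Proof.
  intros HD H Ht. destruct t as [u v].
  apply (differentiable_of_partials (fun u v => f (u, v)) (fun u v => pd_u f (u, v)) u v).
  - generalize (open_locally_2d D (u, v) HD Ht). apply locally_2d_impl, locally_2d_forall.
    intros a b Hab. apply (Ck_partials n D f (a, b) H Hab).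
  - apply (Ck_continuity_2d n D (pd_u f) (u, v)); [apply H|exact Ht].
  - apply (Ck_partials n D f (u, v) H Ht).
Qed.

Lemma Ck_schwarz (n : nat) (D : C -> Prop) (f : C -> R) (t : C) :
  open D -> Ck (S (S n)) D f -> D t -> pd_u (pd_v f) t = pd_v (pd_u f) t.
Proof.
  intros HD H Ht.
  destruct H as (Hc & Hd & Hu & Hv).
  apply (Schwarz (fun u v => f (u, v)) (fst t) (snd t)).
  - generalize (open_locally_2d D t HD Ht). apply locally_2d_impl, locally_2d_forall.
    intros a b Hab. split; [|split; [|split]].
    + apply (Hd (a, b) Hab).
    + apply (Hd (a, b) Hab).
    + apply (proj1 (proj2 Hv) (a, b) Hab).
    + apply (proj1 (proj2 Hu) (a, b) Hab).
  - apply (Ck_continuity_2d n D (pd_u (pd_v f)) t); [apply Hv|exact Ht].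
  - apply (Ck_continuity_2d n D (pd_v (pd_u f)) t); [apply Hu|exact Ht].
Qed.

Lemma dot_lin_comb (w w' u v : vec R) (a b a' b' : R) :
  dot (fun i => w i - (a * u i + b * v i)) (fun i => w' i - (a' * u i + b' * v i)) =
  dot w w' - a' * dot w u - b' * dot w v - a * dot w' u - b * dot w' v +
  a * a' * dot u u + (a * b' + a' * b) * dot u v + b * b' * dot v v.
Proof. unfold dot. ring. Qed.

Lemma dot_comm (u v : vec R) : dot u v = dot v u.
Proof. unfold dot. ring. Qed.

Lemma dot_scal (a b : R) (u v : vec R) :
  dot (fun i => a * u i) (fun i => b * v i) = a * b * dot u v.
Proof. unfold dot. ring. Qed.

Lemma dot_scal_l (a : R) (u v : vec R) : dot (fun i => a * u i) v = a * dot u v.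
Proof. unfold dot. ring. Qed.

Lemma is_derive_vec_dot (y w : R -> vec R) (y' w' : vec R) (t : R) :
  (forall i, is_derive (fun r => y r i) t (y' i)) -> (forall i, is_derive (fun r => w r i) t (w' i)) ->
  is_derive (fun r => dot (y r) (w r)) t (dot y' (w t) + dot (y t) w').
Proof.
  intros Hy Hw. apply is_derive_Reals.
  assert (M : forall i, derivable_pt_lim (fun r => y r i * w r i) t (y' i * w t i + y t i * w' i)).
  { intros i. apply (derivable_pt_lim_mult (fun r => y r i) (fun r => w r i));
    apply is_derive_Reals; [apply Hy|apply Hw]. }
  replace (dot y' (w t) + dot (y t) w') with
    ((y' e1 * w t e1 + y t e1 * w' e1) + (y' e2 * w t e2 + y t e2 * w' e2) +
     (y' e3 * w t e3 + y t e3 * w' e3) - (y' e4 * w t e4 + y t e4 * w' e4)) by (unfold dot; ring).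
  exact (derivable_pt_lim_minus _ _ _ _ _ (derivable_pt_lim_plus _ _ _ _ _
     (derivable_pt_lim_plus _ _ _ _ _ (M e1) (M e2)) (M e3)) (M e4)).
Qed.

Lemma pd_dot (y w : C -> vec R) (t : C) :
  (forall i, has_partials (fun z => y z i) t) -> (forall i, has_partials (fun z => w z i) t) ->
  pd_u (fun z => dot (y z) (w z)) t = dot (Du y t) (w t) + dot (y t) (Du w t) /\
  pd_v (fun z => dot (y z) (w z)) t = dot (Dv y t) (w t) + dot (y t) (Dv w t).
Proof.
  intros Hy Hw. destruct t as [u v]. split; apply is_derive_unique.
  - exact (is_derive_vec_dot (fun r => y (r, v)) (fun r => w (r, v)) _ _ u
      (fun i => proj1 (Hy i)) (fun i => proj1 (Hw i))).
  - exact (is_derive_vec_dot (fun r => y (u, r)) (fun r => w (u, r)) _ _ v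
      (fun i => proj2 (Hy i)) (fun i => proj2 (Hw i))).
Qed.

Section Surface.
Variables (D : C -> Prop) (x : C -> vec R).
Hypothesis HD : open D.
Hypothesis Hx : smooth D x.

Lemma smooth_partials t i : D t ->
  has_partials (fun z => x z i) t /\ has_partials (fun z => Du x z i) t /\
  has_partials (fun z => Dv x z i) t.
Proof.
  intros Ht. pose proof (Hx i 2%nat) as H.
  split; [exact (Ck_partials _ D _ t H Ht)|].
  destruct H as (_ & _ & Hu & Hv).
  split; [exact (Ck_partials _ D _ t Hu Ht)|exact (Ck_partials _ D _ t Hv Ht)].
Qed.

Lemma smooth_schwarz t i : D t -> Du (Dv x) t i = Dv (Du x) t i.
Proof. intros Ht. exact (Ck_schwarz 0 D (fun z => x z i) t HD (Hx i 2%nat) Ht). Qed.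

(** By the symmetry of second derivatives the flat derivative of constant-coordinate fields is
    symmetric in [X] and [Y], so three second derivatives of [x] suffice. *)
Lemma nabla_coordinates t X Y : D t ->
  nabla x t X Y = fun i =>
    fst X * fst Y * Du (Du x) t i + (fst X * snd Y + snd X * fst Y) * Dv (Du x) t i +
    snd X * snd Y * Dv (Dv x) t i.
Proof.
  intros Ht. apply functional_extensionality. intros i.
  destruct (smooth_partials t i Ht) as (_ & [Huu Huv] & [Hvu Hvv]).
  unfold nabla.
  assert (EU : Du (fun z => tangent x z Y) t i = fst Y * Du (Du x) t i + snd Y * Du (Dv x) t i).
  { apply is_derive_unique. unfold tangent.
    apply (is_derive_plus (V := R_NormedModule)); apply is_derive_scal; assumption. }
  assert (EV : Dv (fun z => tangent x z Y) t i = fst Y * Dv (Du x) t i + snd Y * Dv (Dv x) t i).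
  { apply is_derive_unique. unfold tangent.
    apply (is_derive_plus (V := R_NormedModule)); apply is_derive_scal; assumption. }
  rewrite EU, EV, (smooth_schwarz t i Ht). ring.
Qed.

Hypothesis Hiso : isothermal D x.

(** Derivatives of the relations [x_u . x_u = x_v . x_v] and [x_u . x_v = 0]: the tangential parts of
    [x_uu], [x_uv] and [x_vv] are governed by the two numbers [x_uu . x_u] and [x_uu . x_v] alone, and
    the Laplacian of [x] is normal. *)
Lemma isothermal_derived t : D t ->
  dot (Dv (Du x) t) (Dv x t) = dot (Du (Du x) t) (Du x t) /\
  dot (Dv (Du x) t) (Du x t) = - dot (Du (Du x) t) (Dv x t) /\
  dot (Dv (Dv x) t) (Du x t) = - dot (Du (Du x) t) (Du x t) /\
  dot (Dv (Dv x) t) (Dv x t) = - dot (Du (Du x) t) (Dv x t).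
Proof.
  intros Ht.
  assert (PU : forall i, has_partials (fun z => Du x z i) t)
    by exact (fun i => proj1 (proj2 (smooth_partials t i Ht))).
  assert (PV : forall i, has_partials (fun z => Dv x z i) t)
    by exact (fun i => proj2 (proj2 (smooth_partials t i Ht))).
  destruct (pd_ext D (gE x) (gG x) HD (fun z Hz => proj1 (Hiso z Hz)) t Ht) as [E1 E2].
  destruct (pd_ext D (gF x) (fun _ => 0) HD (fun z Hz => proj2 (Hiso z Hz)) t Ht) as [E3 E4].
  unfold gE, gG, gF in E1, E2, E3, E4.
  rewrite (proj1 (pd_dot _ _ t PU PU)), (proj1 (pd_dot _ _ t PV PV)) in E1.
  rewrite (proj2 (pd_dot _ _ t PU PU)), (proj2 (pd_dot _ _ t PV PV)) in E2.
  rewrite (proj1 (pd_dot _ _ t PU PV)) in E3. rewrite (proj2 (pd_dot _ _ t PU PV)) in E4.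
  unfold pd_u in E3. rewrite Derive_const in E3. unfold pd_v in E4. rewrite Derive_const in E4.
  assert (S : Du (Dv x) t = Dv (Du x) t).
  { apply functional_extensionality. intros i. apply smooth_schwarz, Ht. }
  rewrite S in *.
  rewrite (dot_comm (Du x t) (Du (Du x) t)), (dot_comm (Dv x t) (Dv (Du x) t)) in E1.
  rewrite (dot_comm (Du x t) (Dv (Du x) t)), (dot_comm (Dv x t) (Dv (Dv x) t)) in E2.
  rewrite (dot_comm (Du x t) (Dv (Du x) t)) in E3.
  rewrite (dot_comm (Du x t) (Dv (Dv x) t)) in E4.
  lra.
Qed.

Lemma normal_part_isothermal t w : D t -> gE x t <> 0 ->
  normal_part x t w = fun i =>
    w i - (dot w (Du x t) / gE x t * Du x t i + dot w (Dv x t) / gE x t * Dv x t i).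
Proof.
  intros Ht HE. apply functional_extensionality. intros i.
  destruct (Hiso t Ht) as [HG HF].
  unfold normal_part, tangent, gdet. simpl. rewrite HF, <- HG. field. exact HE.
Qed.

Lemma dot_normal_part t w w' : D t -> gE x t <> 0 ->
  dot (normal_part x t w) (normal_part x t w') =
  dot w w' - (dot w (Du x t) * dot w' (Du x t) + dot w (Dv x t) * dot w' (Dv x t)) / gE x t.
Proof.
  intros Ht HE. rewrite !normal_part_isothermal, dot_lin_comb by assumption.
  destruct (Hiso t Ht) as [HG HF]. unfold gE, gG, gF in *. rewrite <- HG, HF. field. exact HE.
Qed.

(** The Laplacian is normal, so projecting it to the normal space changes nothing: minimality means
    that the coordinates of [x] are harmonic. *)
Lemma mean_curvature_isothermal t i : D t -> gE x t <> 0 ->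
  mean_curvature x t i = / (2 * gE x t) * (Du (Du x) t i + Dv (Dv x) t i).
Proof.
  intros Ht HE. unfold mean_curvature, Defs.sigma.
  rewrite !nabla_coordinates, !normal_part_isothermal by assumption. simpl.
  assert (F : forall a b c, a = 1 -> b = 0 -> c = 0 ->
     (fun i => a * Du (Du x) t i + b * Dv (Du x) t i + c * Dv (Dv x) t i) = Du (Du x) t).
  { intros a b c -> -> ->. apply functional_extensionality. intros j. ring. }
  assert (G : forall a b c, a = 0 -> b = 0 -> c = 1 ->
     (fun i => a * Du (Du x) t i + b * Dv (Du x) t i + c * Dv (Dv x) t i) = Dv (Dv x) t).
  { intros a b c -> -> ->. apply functional_extensionality. intros j. ring. }
  rewrite (F (1 * 1) (1 * 0 + 0 * 1) (0 * 0)), (G (0 * 0) (0 * 1 + 1 * 0) (1 * 1)) by ring.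
  destruct (Hiso t Ht) as [HG HF].
  destruct (isothermal_derived t Ht) as (_ & _ & I3 & I4).
  unfold gdet. rewrite HF, <- HG, I3, I4. field. exact HE.
Qed.

(** The tangential parts of [x_uu] and [x_uv] are orthogonal and of equal length, so they drop out of
    both expressions. *)
Lemma canonical_isothermal t : D t -> 0 < gE x t ->
  let X1 := (/ sqrt (gE x t), 0) in
  let X2 := (0, / sqrt (gE x t)) in
  dot (Defs.sigma x t X1 X1) (Defs.sigma x t X1 X2) =
    dot (Du (Du x) t) (Dv (Du x) t) / gE x t ^ 2 /\
  dot (Defs.sigma x t X1 X1) (Defs.sigma x t X1 X1) - dot (Defs.sigma x t X1 X2) (Defs.sigma x t X1 X2) =
    (dot (Du (Du x) t) (Du (Du x) t) - dot (Dv (Du x) t) (Dv (Du x) t)) / gE x t ^ 2.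
Proof.
  intros Ht HE X1 X2. unfold Defs.sigma.
  assert (HE0 : gE x t <> 0) by lra.
  assert (Hs : / sqrt (gE x t) * / sqrt (gE x t) = / gE x t).
  { rewrite <- Rinv_mult, sqrt_sqrt; lra. }
  assert (E1 : nabla x t X1 X1 = fun i => / gE x t * Du (Du x) t i).
  { rewrite nabla_coordinates by exact Ht. apply functional_extensionality. intros i.
    simpl. rewrite Hs. ring. }
  assert (E2 : nabla x t X1 X2 = fun i => / gE x t * Dv (Du x) t i).
  { rewrite nabla_coordinates by exact Ht. apply functional_extensionality. intros i.
    simpl. rewrite <- Hs. ring. }
  rewrite E1, E2, !dot_normal_part, !dot_scal, !dot_scal_l by assumption.
  destruct (isothermal_derived t Ht) as (I1 & I2 & _ & _).
  rewrite I1, I2. split; field; exact HE0.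
Qed.

End Surface.

(** * Null curves and the Weierstrass formulas *)

Definition cdot (a b : vec C) : C :=
  (a e1 * b e1 + a e2 * b e2 + a e3 * b e3 - a e4 * b e4)%C.

Definition hermitian (a : vec C) : C := cdot a (fun i => Cconj (a i)).

Definition holomorphic_curve (U : C -> Prop) (phi phi' : C -> vec C) : Prop :=
  forall t, U t -> forall i, is_C_derive (fun z => phi z i) t (phi' t i).

(** Holomorphic curves with [phi . phi = 0] and [phi' . phi' = 1], and with non-zero hermitian square.
    The first relation encodes isothermal parameters, the second canonical ones, the third a
    non-degenerate metric. *)
Definition canonical_curve (U : C -> Prop) (phi phi' : C -> vec C) : Prop :=
  holomorphic_curve U phi phi' /\
  forall t, U t -> cdot (phi t) (phi t) = RtoC 0 /\ cdot (phi' t) (phi' t) = RtoC 1 /\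
    hermitian (phi t) <> RtoC 0.

Lemma is_C_derive_cdot (phi psi : C -> vec C) (phi' psi' : vec C) (t : C) :
  (forall i, is_C_derive (fun z => phi z i) t (phi' i)) ->
  (forall i, is_C_derive (fun z => psi z i) t (psi' i)) ->
  is_C_derive (fun z => cdot (phi z) (psi z)) t (cdot phi' (psi t) + cdot (phi t) psi')%C.
Proof.
  intros H1 H2.
  replace (cdot phi' (psi t) + cdot (phi t) psi')%C with
   ((phi' e1 * psi t e1 + phi t e1 * psi' e1) + (phi' e2 * psi t e2 + phi t e2 * psi' e2) +
    (phi' e3 * psi t e3 + phi t e3 * psi' e3) - (phi' e4 * psi t e4 + phi t e4 * psi' e4))%C
   by (unfold cdot; ring).
  unfold cdot. apply is_C_derive_minus; [apply is_C_derive_plus; [apply is_C_derive_plus|]|];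
    apply is_C_derive_mult; auto.
Qed.

Lemma null_curve_derived (U : C -> Prop) (phi phi' : C -> vec C) (t : C) :
  open U -> holomorphic_curve U phi phi' ->
  (forall z, U z -> cdot (phi z) (phi z) = RtoC 0) -> U t ->
  cdot (phi t) (phi' t) = RtoC 0.
Proof.
  intros HU Hphi H0 Ht.
  pose proof (is_C_derive_cdot phi phi (phi' t) (phi' t) t (Hphi t Ht) (Hphi t Ht)) as H.
  assert (K : is_C_derive (fun z => cdot (phi z) (phi z)) t (RtoC 0)).
  { apply (is_C_derive_ext_loc (fun _ => RtoC 0)); [|apply is_C_derive_const].
    generalize (open_locally_2d U t HU Ht). apply locally_2d_impl, locally_2d_forall.
    intros u v Huv. symmetry. apply H0, Huv. }
  pose proof (is_C_derive_inj _ _ _ _ H K) as E.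
  assert (E' : (cdot (phi t) (phi' t) + cdot (phi t) (phi' t))%C = RtoC 0).
  { rewrite <- E. unfold cdot. ring. }
  replace (cdot (phi t) (phi' t)) with
    (/ 2 * (cdot (phi t) (phi' t) + cdot (phi t) (phi' t)))%C by field.
  rewrite E'. ring.
Qed.

(** Linear coordinates of C^4 in which the quadratic form is [a b + c d]. *)
Definition coord_a (w : vec C) : C := (w e2 + Ci * w e1)%C.
Definition coord_b (w : vec C) : C := (w e2 - Ci * w e1)%C.
Definition coord_c (w : vec C) : C := (w e3 + w e4)%C.
Definition coord_d (w : vec C) : C := (w e3 - w e4)%C.

Lemma null_coordinates_cdot (v w : vec C) :
  (cdot v w + cdot v w)%C = (coord_a v * coord_b w + coord_b v * coord_a w + coord_c v * coord_d w + coord_d v * coord_c w)%C.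
Proof.
  unfold coord_a, coord_b, coord_c, coord_d, cdot.
  replace ((v e2 + Ci * v e1) * (w e2 - Ci * w e1) + (v e2 - Ci * v e1) * (w e2 + Ci * w e1) +
    (v e3 + v e4) * (w e3 - w e4) + (v e3 - v e4) * (w e3 + w e4))%C with
   ((v e2 * w e2 - (Ci * Ci) * v e1 * w e1 + v e3 * w e3 - v e4 * w e4) +
    (v e2 * w e2 - (Ci * Ci) * v e1 * w e1 + v e3 * w e3 - v e4 * w e4))%C by ring.
  rewrite Ci_sqr. ring.
Qed.

Lemma Cdouble_inj (a b : C) : (a + a)%C = (b + b)%C -> a = b.
Proof.
  intros H. replace a with (/ 2 * (a + a))%C by field. rewrite H. field.
Qed.

Lemma null_coordinates_sqr (w : vec C) :
  cdot w w = (coord_a w * coord_b w + coord_c w * coord_d w)%C.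
Proof. apply Cdouble_inj. rewrite null_coordinates_cdot. ring. Qed.

Lemma null_coordinates_hermitian (w : vec C) :
  (hermitian w + hermitian w)%C =
  (coord_a w * Cconj (coord_a w) + coord_b w * Cconj (coord_b w) +
   coord_c w * Cconj (coord_d w) + coord_d w * Cconj (coord_c w))%C.
Proof.
  unfold hermitian. rewrite null_coordinates_cdot.
  replace (coord_a (fun i => Cconj (w i))) with (Cconj (coord_b w)).
  2: { unfold coord_a, coord_b. apply injective_projections; simpl; ring. }
  replace (coord_b (fun i => Cconj (w i))) with (Cconj (coord_a w)).
  2: { unfold coord_a, coord_b. apply injective_projections; simpl; ring. }
  replace (coord_c (fun i => Cconj (w i))) with (Cconj (coord_c w)).
  2: { unfold coord_c. apply injective_projections; simpl; ring. }
  replace (coord_d (fun i => Cconj (w i))) with (Cconj (coord_d w)).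
  2: { unfold coord_d. apply injective_projections; simpl; ring. }
  ring.
Qed.

Lemma is_C_derive_null_coordinates (phi : C -> vec C) (t : C) (phi' : vec C) :
  (forall i, is_C_derive (fun z => phi z i) t (phi' i)) ->
  is_C_derive (fun z => coord_a (phi z)) t (coord_a phi') /\
  is_C_derive (fun z => coord_b (phi z)) t (coord_b phi') /\
  is_C_derive (fun z => coord_c (phi z)) t (coord_c phi') /\
  is_C_derive (fun z => coord_d (phi z)) t (coord_d phi').
Proof.
  intros H. unfold coord_a, coord_b, coord_c, coord_d. split; [|split; [|split]].
  - apply is_C_derive_plus; [|apply is_C_derive_scal]; apply H.
  - apply is_C_derive_minus; [|apply is_C_derive_scal]; apply H.
  - apply is_C_derive_plus; apply H.
  - apply is_C_derive_minus; apply H.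
Qed.

Lemma Cmult_integral_l (a b : C) : (a * b)%C = RtoC 0 -> a <> RtoC 0 -> b = RtoC 0.
Proof.
  intros H Ha. destruct (Ceq_dec b 0) as [E|E]; [exact E|].
  exfalso. apply (Cmult_neq_0 a b Ha E H).
Qed.

(** Twice the hermitian square is [|a|^2 + |b|^2 + 2 Re (c (conj d))].  If [c (conj d) = - |a|^2], then
    [|a| |b| = |c| |d| = |a|^2], so [|b| = |a|] and everything cancels.  For
    [g1 = - c / a] and [g2 = - d / a] the condition is [g1 (conj g2) = - 1]: these are antipodal points
    of the Riemann sphere. *)
Lemma hermitian_zero_of_antipodal (w : vec C) :
  cdot w w = RtoC 0 -> coord_a w <> RtoC 0 ->
  (coord_c w * Cconj (coord_d w))%C = (- (coord_a w * Cconj (coord_a w)))%C -> hermitian w = RtoC 0.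
Proof.
  intros H0 Ha Hcd. apply Cdouble_inj.
  rewrite null_coordinates_hermitian.
  assert (Hdc : (coord_d w * Cconj (coord_c w))%C = (- (coord_a w * Cconj (coord_a w)))%C).
  { rewrite <- (Cconj_conj (coord_d w)), <- Cmult_conj, (Cmult_comm (Cconj _)), Hcd.
    rewrite Copp_conj, Cmult_conj, Cconj_conj. ring. }
  assert (Ha' : Cconj (coord_a w) <> RtoC 0).
  { intros E. apply Ha. rewrite <- (Cconj_conj (coord_a w)), E. apply injective_projections; simpl; ring. }
  assert (Hab : (coord_a w * coord_b w)%C = (- (coord_c w * coord_d w))%C).
  { rewrite null_coordinates_sqr in H0.
    replace (coord_a w * coord_b w)%C with ((coord_a w * coord_b w + coord_c w * coord_d w) - coord_c w * coord_d w)%C by ring.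
    rewrite H0. ring. }
  assert (Hab' : (Cconj (coord_a w) * Cconj (coord_b w))%C = (- (Cconj (coord_c w) * Cconj (coord_d w)))%C).
  { rewrite <- !Cmult_conj, Hab, Copp_conj. reflexivity. }
  rewrite Hcd, Hdc.
  replace (RtoC 0 + RtoC 0)%C with (RtoC 0) by ring.
  apply (Cmult_integral_l (coord_a w * Cconj (coord_a w))); [|apply Cmult_neq_0; assumption].
  replace (coord_a w * Cconj (coord_a w) * (coord_a w * Cconj (coord_a w) + coord_b w * Cconj (coord_b w) +
      - (coord_a w * Cconj (coord_a w)) + - (coord_a w * Cconj (coord_a w))))%C with
    ((coord_a w * coord_b w) * (Cconj (coord_a w) * Cconj (coord_b w)) -
      (coord_a w * Cconj (coord_a w)) * (coord_a w * Cconj (coord_a w)))%C by ring.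
  rewrite Hab, Hab'.
  replace (- (coord_c w * coord_d w) * - (Cconj (coord_c w) * Cconj (coord_d w)))%C with
    ((coord_c w * Cconj (coord_d w)) * (coord_d w * Cconj (coord_c w)))%C by ring.
  rewrite Hcd, Hdc. ring.
Qed.

(** [(c / a)' (d / a)' = (c' a - c a') (d' a - d a') / a^4], where the numerator is
    [a^2 (a' b' + c' d') - a a' (a b + c d)' + a'^2 (a b + c d)]. *)
Lemma weierstrass_derivative_identity (a b c d a' b' c' d' : C) :
  a <> RtoC 0 -> (a * b + c * d)%C = RtoC 0 ->
  (a' * b + a * b' + c' * d + c * d')%C = RtoC 0 -> (a' * b' + c' * d')%C = RtoC 1 ->
  ((- c' * / a + - c * (a' * - / (a * a))) * (- d' * / a + - d * (a' * - / (a * a))))%C =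
  (- / a * - / a)%C.
Proof.
  intros Ha H0 H1 H2.
  replace ((- c' * / a + - c * (a' * - / (a * a))) * (- d' * / a + - d * (a' * - / (a * a))))%C with
   ((a * a * (a' * b' + c' * d') - a * a' * (a' * b + a * b' + c' * d + c * d') +
     a' * a' * (a * b + c * d)) / (a * a * (a * a)))%C by (field; exact Ha).
  rewrite H0, H1, H2. field. exact Ha.
Qed.

(** Where [a] does not vanish, [s = - 1 / a], [g1 = - c / a] and [g2 = - d / a] are the only possible
    choice: the Weierstrass formulas say [(a, b, c, d) = (- 1, g1 g2, g1, g2) / s]. *)
Theorem canonical_curve_weierstrass (U : C -> Prop) (phi phi' : C -> vec C) :
  open U -> canonical_curve U phi phi' -> (forall t, U t -> coord_a (phi t) <> RtoC 0) ->
  exists g1 g2 s, weierstrass_pair U g1 g2 /\ g_sqrt_branch U g1 g2 s /\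
    forall t, U t -> forall i, phi t i = weierstrass_Phi g1 g2 s t i.
Proof.
  intros HU [Hphi Hcan] Ha.
  pose (a z := coord_a (phi z)). pose (b z := coord_b (phi z)).
  pose (c z := coord_c (phi z)). pose (d z := coord_d (phi z)).
  exists (fun z => - c z * / a z)%C, (fun z => - d z * / a z)%C, (fun z => - / a z)%C.
  assert (Dg1 : forall t, U t -> is_C_derive (fun z => - c z * / a z)%C t
     (- coord_c (phi' t) * / a t + - c t * (coord_a (phi' t) * - / (a t * a t)))%C).
  { intros t Ht. destruct (is_C_derive_null_coordinates phi t (phi' t) (Hphi t Ht)) as (Da & _ & Dc & _).
    apply (is_C_derive_mult (fun z => - c z)%C (fun z => / a z)%C);
      [apply (is_C_derive_opp c), Dc|apply (is_C_derive_inv a); [exact Da|apply Ha, Ht]]. }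
  assert (Dg2 : forall t, U t -> is_C_derive (fun z => - d z * / a z)%C t
     (- coord_d (phi' t) * / a t + - d t * (coord_a (phi' t) * - / (a t * a t)))%C).
  { intros t Ht. destruct (is_C_derive_null_coordinates phi t (phi' t) (Hphi t Ht)) as (Da & _ & _ & Dd).
    apply (is_C_derive_mult (fun z => - d z)%C (fun z => / a z)%C);
      [apply (is_C_derive_opp d), Dd|apply (is_C_derive_inv a); [exact Da|apply Ha, Ht]]. }
  assert (Hs : forall t, U t ->
    (C_derive (fun z => - c z * / a z) t * C_derive (fun z => - d z * / a z) t)%C =
    (- / a t * - / a t)%C).
  { intros t Ht.
    pose proof (is_C_derive_unique (fun z => - c z * / a z)%C t _ (Dg1 t Ht)) as E1.
    pose proof (is_C_derive_unique (fun z => - d z * / a z)%C t _ (Dg2 t Ht)) as E2.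
    rewrite E1, E2. clear E1 E2.
    destruct (Hcan t Ht) as (H0 & H1 & _).
    apply (weierstrass_derivative_identity _ (b t) _ _ _ (coord_b (phi' t))).
    - apply Ha, Ht.
    - unfold a, b, c, d. rewrite <- null_coordinates_sqr. exact H0.
    - pose proof (null_curve_derived U phi phi' t HU Hphi (fun z Hz => proj1 (Hcan z Hz)) Ht) as H.
      pose proof (null_coordinates_cdot (phi t) (phi' t)) as K. rewrite H in K.
      transitivity (RtoC 0 + RtoC 0)%C; [rewrite K; unfold a, b, c, d; ring|ring].
    - rewrite <- null_coordinates_sqr. exact H1. }
  assert (Hinv : forall t, U t -> (- / a t)%C <> RtoC 0).
  { intros t Ht E. apply (C1_nz).
    replace (RtoC 1) with (- (- / a t * a t))%C by (field; apply Ha, Ht). rewrite E. ring. }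
  split; [split; [|split]|split; [split|]].
  - intros t Ht. eexists. apply Dg1, Ht.
  - intros t Ht. eexists. apply Dg2, Ht.
  - intros t Ht. split.
    + rewrite Hs by exact Ht. apply Cmult_neq_0; apply Hinv, Ht.
    + intros E. destruct (Hcan t Ht) as (H0 & _ & Hh). apply Hh.
      apply hermitian_zero_of_antipodal; [exact H0|apply Ha, Ht|].
      fold (a t) (c t) (d t).
      assert (Ha' : Cconj (a t) <> RtoC 0).
      { intros E'. apply (Ha t Ht). fold (a t). rewrite <- (Cconj_conj (a t)), E'.
        apply injective_projections; simpl; ring. }
      rewrite Cmult_conj, Copp_conj, Cinv_conj in E by (apply Ha, Ht).
      replace (c t * Cconj (d t))%C with
        ((- c t * / a t * (- Cconj (d t) * / Cconj (a t))) * (a t * Cconj (a t)))%C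
        by (field; split; [exact Ha'|apply Ha, Ht]).
      rewrite E. replace (RtoC (-1)) with (- RtoC 1)%C by (rewrite <- RtoC_opp; reflexivity). ring.
  - intros t Ht. eexists. apply is_C_derive_opp.
    apply (is_C_derive_inv a); [|apply Ha, Ht].
    exact (proj1 (is_C_derive_null_coordinates phi t (phi' t) (Hphi t Ht))).
  - intros t Ht. symmetry. apply Hs, Ht.
  - intros t Ht i.
    assert (Ha0 : a t <> RtoC 0) by (apply Ha, Ht).
    assert (Hcd : (- c t * - d t)%C = (- (a t * b t))%C).
    { destruct (Hcan t Ht) as (H0 & _). rewrite null_coordinates_sqr in H0.
      fold (a t) (b t) (c t) (d t) in H0.
      replace (- c t * - d t)%C with (a t * b t + c t * d t - a t * b t)%C by ring.
      rewrite H0. ring. }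
    assert (Hgg : (- c t * / a t * (- d t * / a t))%C = (- b t * / a t)%C).
    { replace (- c t * / a t * (- d t * / a t))%C with (- c t * - d t * (/ a t * / a t))%C by ring.
      rewrite Hcd. field. exact Ha0. }
    assert (Hm1 : (Ci * Ci)%C = (- RtoC 1)%C) by apply Ci_sqr.
    destruct i; unfold weierstrass_Phi; rewrite ?Hgg.
    + replace (Ci / 2 * ((- b t * / a t + 1) / - / a t))%C with (- (Ci / 2) * (a t - b t))%C
        by (field; exact Ha0).
      unfold a, b, coord_a, coord_b.
      replace (- (Ci / 2) * (phi t e2 + Ci * phi t e1 - (phi t e2 - Ci * phi t e1)))%C with
        (- (Ci * Ci) * phi t e1)%C by field. rewrite Hm1. ring.
    + replace (1 / 2 * ((- b t * / a t - 1) / - / a t))%C with (1 / 2 * (a t + b t))%C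
        by (field; exact Ha0).
      unfold a, b, coord_a, coord_b. field.
    + replace (1 / 2 * ((- c t * / a t + - d t * / a t) / - / a t))%C with (1 / 2 * (c t + d t))%C
        by (field; exact Ha0).
      unfold c, d, coord_c, coord_d. field.
    + replace (1 / 2 * ((- c t * / a t - - d t * / a t) / - / a t))%C with (1 / 2 * (c t - d t))%C
        by (field; exact Ha0).
      unfold c, d, coord_c, coord_d. field.
Qed.

(** * Surfaces and canonical curves *)

Definition Re_vec (w : vec C) : vec R := fun i => Re (w i).
Definition Im_vec (w : vec C) : vec R := fun i => Im (w i).

Lemma cdot_Re_Im (w : vec C) :
  cdot w w = (dot (Re_vec w) (Re_vec w) - dot (Im_vec w) (Im_vec w),
              2 * dot (Re_vec w) (Im_vec w)).
Proof. apply injective_projections; unfold dot, Re_vec, Im_vec, Re, Im; simpl; ring. Qed.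

Lemma hermitian_Re_Im (w : vec C) :
  hermitian w = RtoC (dot (Re_vec w) (Re_vec w) + dot (Im_vec w) (Im_vec w)).
Proof. apply injective_projections; unfold dot, Re_vec, Im_vec, Re, Im; simpl; ring. Qed.

Lemma complex_vec_cdot (w : vec C) (p q : vec R) :
  (forall i, w i = (RtoC (p i) - Ci * RtoC (q i))%C) ->
  cdot w w = (dot p p - dot q q, - 2 * dot p q) /\ hermitian w = RtoC (dot p p + dot q q).
Proof.
  intros Hw.
  assert (E : w = fun i => (RtoC (p i) - Ci * RtoC (q i))%C)
    by (apply functional_extensionality; exact Hw).
  subst w. rewrite cdot_Re_Im, hermitian_Re_Im. split; [apply injective_projections|f_equal];
    unfold dot, Re_vec, Im_vec, Re, Im; simpl; ring.
Qed.

Definition Phi_derivative (x : C -> vec R) (t : C) : vec C :=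
  fun i => (RtoC (Du (Du x) t i) - Ci * RtoC (Dv (Du x) t i))%C.

Lemma dot_tangent (x : C -> vec R) (t : C) (X : R * R) :
  dot (tangent x t X) (tangent x t X) =
  fst X * fst X * gE x t + 2 * (fst X * snd X) * gF x t + snd X * snd X * gG x t.
Proof. unfold dot, tangent, gE, gF, gG, dot. ring. Qed.

Lemma spacelike_gE_pos (D : C -> Prop) (x : C -> vec R) (t : C) :
  spacelike_surface D x -> D t -> 0 < gE x t.
Proof.
  intros [_ H] Ht. specialize (H t Ht (1, 0)). rewrite dot_tangent in H. simpl in H.
  assert (H10 : (1, 0) <> (0, 0)) by (intros E; injection E; lra).
  specialize (H H10). lra.
Qed.

(** The Cauchy-Riemann equations for [x_u - i x_v] are the vanishing of the Laplacian of [x] and the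
    symmetry of its second derivatives. *)
Lemma harmonic_Phi_derive (D : C -> Prop) (x : C -> vec R) :
  open D -> smooth D x ->
  (forall t, D t -> forall i, Du (Du x) t i + Dv (Dv x) t i = 0) ->
  holomorphic_curve D (Phi x) (Phi_derivative x).
Proof.
  intros HD Hx Hlap t Ht i. apply is_derive_C_iff.
  destruct (Hx i 2%nat) as (_ & _ & Hu & Hv).
  pose proof (Ck_differentiable 0 D _ t HD Hu Ht) as DU.
  pose proof (Ck_differentiable 0 D _ t HD Hv Ht) as DV.
  split.
  - apply (differentiable_pt_lim_ext (fun u v => Du x (u, v) i)).
    { apply locally_2d_forall. intros u v. simpl. ring. }
    replace (fst (Phi_derivative x t i)) with (Du (Du x) t i) by (simpl; ring).
    replace (- snd (Phi_derivative x t i)) with (Dv (Du x) t i) by (simpl; ring).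
    exact DU.
  - apply (differentiable_pt_lim_ext (fun u v => - Dv x (u, v) i)).
    { apply locally_2d_forall. intros u v. simpl. ring. }
    replace (snd (Phi_derivative x t i)) with (- Du (Dv x) t i).
    2: { rewrite (smooth_schwarz D x HD Hx t i Ht). simpl. ring. }
    replace (fst (Phi_derivative x t i)) with (- Dv (Dv x) t i).
    2: { specialize (Hlap t Ht i). simpl. lra. }
    intros eps. generalize (DV eps). apply locally_2d_impl, locally_2d_forall.
    intros u v Huv. rewrite <- Rabs_Ropp. eapply Rle_trans; [|exact Huv].
    apply Req_le. f_equal. unfold Du, Dv.
    change (fun z : C => pd_v (fun z0 : C => x z0 i) z) with (pd_v (fun z0 : C => x z0 i)). ring.
Qed.

Theorem surface_canonical_curve (D : C -> Prop) (x : C -> vec R) :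
  open D -> minimal_spacelike_general_canonical D x ->
  canonical_curve D (Phi x) (Phi_derivative x).
Proof.
  intros HD (Hsp & Hmin & _ & Hiso & Hcan).
  pose proof (proj1 Hsp) as Hx.
  split.
  - apply harmonic_Phi_derive; [exact HD|exact Hx|]. intros t Ht i.
    pose proof (spacelike_gE_pos D x t Hsp Ht) as HE.
    specialize (Hmin t Ht i).
    rewrite (mean_curvature_isothermal D) in Hmin by (assumption || lra).
    apply Rmult_integral in Hmin. destruct Hmin as [H|H]; [exfalso|exact H].
    revert H. apply Rinv_neq_0_compat. lra.
  - intros t Ht. pose proof (spacelike_gE_pos D x t Hsp Ht) as HE.
    destruct (Hiso t Ht) as [HG HF].
    destruct (complex_vec_cdot (Phi x t) (Du x t) (Dv x t)) as [C1 C2]; [reflexivity|].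
    destruct (complex_vec_cdot (Phi_derivative x t) (Du (Du x) t) (Dv (Du x) t)) as [C3 _];
      [reflexivity|].
    specialize (Hcan t Ht). simpl in Hcan. destruct Hcan as [H1 H2].
    pose proof (canonical_isothermal D x HD Hx Hiso t Ht HE) as [E1 E2]. simpl in E1, E2.
    rewrite E1 in H1. rewrite E2 in H2. clear E1 E2.
    assert (HE2 : gE x t * (gE x t * 1) <> 0) by (simpl; nra).
    rewrite C1, C2, C3. split; [|split].
    + unfold gE, gG, gF in *. apply injective_projections; simpl; lra.
    + assert (M : dot (Du (Du x) t) (Dv (Du x) t) = 0).
      { apply Rmult_eq_reg_r with (/ (gE x t * (gE x t * 1))); [|apply Rinv_neq_0_compat, HE2].
        rewrite Rmult_0_l. exact H1. }
      assert (N : dot (Du (Du x) t) (Du (Du x) t) - dot (Dv (Du x) t) (Dv (Du x) t) = 1).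
      { rewrite <- H2. field. lra. }
      apply injective_projections; simpl; [exact N|rewrite M; ring].
    + intros E. apply RtoC_inj in E. unfold gE, gG in *. lra.
Qed.

(** At a zero of [a], [c d = - a b = 0] and the hermitian square is [|b|^2 / 2], so [b] is not zero.  If
    [c] and [c'] vanished there, [(a b + c d)' = 0] would give [a' b = 0], hence [a' = 0], against
    [a' b' + c' d' = 1]. *)
Lemma canonical_curve_coord_a_zero (U : C -> Prop) (phi phi' : C -> vec C) (t : C) :
  open U -> canonical_curve U phi phi' -> U t -> coord_a (phi t) = RtoC 0 ->
  coord_b (phi t) <> RtoC 0 /\
  (coord_c (phi t) = RtoC 0 -> coord_c (phi' t) <> RtoC 0) /\
  (coord_d (phi t) = RtoC 0 -> coord_d (phi' t) <> RtoC 0).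
Proof.
  intros HU [Hphi Hcan] Ht Ha.
  destruct (Hcan t Ht) as (H0 & H1 & Hh).
  pose proof (null_curve_derived U phi phi' t HU Hphi (fun z Hz => proj1 (Hcan z Hz)) Ht) as H2.
  pose proof (null_coordinates_cdot (phi t) (phi' t)) as K. rewrite H2, Ha in K.
  rewrite null_coordinates_sqr, Ha in H0. rewrite null_coordinates_sqr in H1.
  assert (C0 : Cconj (RtoC 0) = RtoC 0) by (apply injective_projections; simpl; ring).
  assert (Hcd : (coord_c (phi t) * coord_d (phi t))%C = RtoC 0).
  { rewrite <- H0. ring. }
  assert (Hb : coord_b (phi t) <> RtoC 0).
  { intros E. apply Hh. apply Cdouble_inj. rewrite null_coordinates_hermitian, Ha, E, C0.
    destruct (Ceq_dec (coord_c (phi t)) 0) as [Ec|Ec].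
    - rewrite Ec, C0. ring.
    - rewrite (Cmult_integral_l _ _ Hcd Ec), C0. ring. }
  split; [exact Hb|]. split; intros E E'; rewrite E, E' in K; rewrite E' in H1.
  - assert (Ea : coord_a (phi' t) = RtoC 0).
    { apply (Cmult_integral_l (coord_b (phi t))); [|exact Hb].
      transitivity (RtoC 0 + RtoC 0)%C; [rewrite K; ring|ring]. }
    rewrite Ea in H1. apply C1_nz. rewrite <- H1. ring.
  - assert (Ea : coord_a (phi' t) = RtoC 0).
    { apply (Cmult_integral_l (coord_b (phi t))); [|exact Hb].
      transitivity (RtoC 0 + RtoC 0)%C; [rewrite K; ring|ring]. }
    rewrite Ea in H1. apply C1_nz. rewrite <- H1. ring.
Qed.

Lemma eventually_nonzero (f : C -> C) (t l : C) :
  is_C_derive f t l -> (f t = RtoC 0 -> l <> RtoC 0) ->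
  locally_2d (fun u v => (u, v) <> t -> f (u, v) <> RtoC 0) (fst t) (snd t).
Proof.
  intros Hf Hl. destruct (Ceq_dec (f t) 0) as [E|E].
  - rewrite <- E. apply (is_C_derive_neq f t l Hf), Hl, E.
  - generalize (is_C_derive_nonzero f t l Hf E). apply locally_2d_impl, locally_2d_forall.
    intros u v H _. exact H.
Qed.

(** Near a zero of [a] the functions [c] and [d] have at most an isolated zero, and [a b = - c d]. *)
Lemma canonical_curve_coord_a_isolated (U : C -> Prop) (phi phi' : C -> vec C) (t : C) :
  open U -> canonical_curve U phi phi' -> U t ->
  locally_2d (fun u v => (u, v) <> t -> coord_a (phi (u, v)) <> RtoC 0) (fst t) (snd t).
Proof.
  intros HU Hc Ht.
  destruct (is_C_derive_null_coordinates phi t (phi' t) (proj1 Hc t Ht)) as (Da & _ & Dc & Dd).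
  destruct (Ceq_dec (coord_a (phi t)) 0) as [E|E].
  - destruct (canonical_curve_coord_a_zero U phi phi' t HU Hc Ht E) as (Hb & Hcc & Hdd).
    generalize (locally_2d_and _ _ _ _ (open_locally_2d U t HU Ht)
      (locally_2d_and _ _ _ _ (eventually_nonzero _ t _ Dc Hcc) (eventually_nonzero _ t _ Dd Hdd))).
    apply locally_2d_impl, locally_2d_forall. intros u v (Huv & Kc & Kd) Hne Ea.
    apply (Cmult_neq_0 _ _ (Kc Hne) (Kd Hne)).
    destruct (proj2 Hc (u, v) Huv) as (H0 & _). rewrite null_coordinates_sqr, Ea in H0.
    rewrite <- H0. ring.
  - apply (eventually_nonzero (fun z => coord_a (phi z)) t _ Da). intros E'. contradiction.
Qed.

Definition half_turn_C (w : vec C) : vec C :=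
  fun i => match i with
           | e1 => (- w e1)%C | e2 => w e2 | e3 => (- w e3)%C | e4 => w e4
           end.

Lemma Phi_half_turn (x : C -> vec R) (t : C) :
  Phi (fun z => half_turn (x z)) t = half_turn_C (Phi x t).
Proof.
  apply functional_extensionality. intros i.
  destruct i; unfold Phi, half_turn_C, Du, Dv, pd_u, pd_v; simpl; try reflexivity;
  rewrite !Derive_opp, !RtoC_opp; ring.
Qed.

Lemma canonical_curve_half_turn (U : C -> Prop) (phi phi' : C -> vec C) :
  canonical_curve U phi phi' ->
  canonical_curve U (fun t => half_turn_C (phi t)) (fun t => half_turn_C (phi' t)).
Proof.
  intros [Hphi Hcan]. split.
  - intros t Ht i. destruct i; simpl; try apply is_C_derive_opp; apply Hphi, Ht.
  - intros t Ht. destruct (Hcan t Ht) as (H0 & H1 & Hh). split; [|split].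
    + rewrite <- H0. unfold cdot, half_turn_C. ring.
    + rewrite <- H1. unfold cdot, half_turn_C. ring.
    + intros E. apply Hh. rewrite <- E. unfold hermitian, cdot, half_turn_C.
      rewrite !Copp_conj. ring.
Qed.

(** The half turn exchanges [a] and [b]; these never vanish together. *)
Lemma coord_a_half_turn (w : vec C) : coord_a (half_turn_C w) = coord_b w.
Proof. unfold coord_a, coord_b, half_turn_C. ring. Qed.

(** At a degenerate point the second fundamental form has values on a light-like line, where the form
    [dot] is zero; the canonical normalization excludes this. *)
Lemma canonical_not_degenerate (D : C -> Prop) (x : C -> vec R) :
  canonical_first_type D x -> general_type D x.
Proof.
  intros [_ Hcan] t Ht (n & _ & _ & Hn & Hs).
  specialize (Hcan t Ht). simpl in Hcan. destruct Hcan as [_ H].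
  destruct (Hs (/ sqrt (gE x t), 0) (/ sqrt (gE x t), 0)) as [c1 E1].
  destruct (Hs (/ sqrt (gE x t), 0) (0, / sqrt (gE x t))) as [c2 E2].
  apply functional_extensionality in E1, E2. rewrite E1, E2, !dot_scal, Hn in H. lra.
Qed.

(** For [x = Re Psi] with [Psi' = phi]: [x_u = Re phi], [x_v = - Im phi], [x_uu = Re phi' = - x_vv] and
    [x_uv = - Im phi'], so all conditions on [x] are conditions on [phi] and [phi']. *)
Theorem curve_surface (V : C -> Prop) (Psi phi phi' : C -> vec C) :
  open V -> canonical_curve V phi phi' -> (forall t, V t -> 0 < Re (hermitian (phi t))) ->
  holo_primitive V Psi phi ->
  minimal_spacelike_general_canonical V (real_part Psi) /\
  forall t, V t -> forall i, Phi (real_part Psi) t i = phi t i.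
Proof.
  intros HV [Hphi Hcan] Hpos HPsi.
  set (x := real_part Psi).
  assert (Hu : forall t, V t -> Du x t = Re_vec (phi t)).
  { intros t Ht. apply functional_extensionality. intros i.
    destruct (is_C_derive_partials_Re (fun z => Psi z i) t (phi t i) (HPsi t Ht i)) as [Ku Kv].
    exact (is_derive_unique _ _ _ Ku). }
  assert (Hv : forall t, V t -> Dv x t = fun i => - Im (phi t i)).
  { intros t Ht. apply functional_extensionality. intros i.
    destruct (is_C_derive_partials_Re (fun z => Psi z i) t (phi t i) (HPsi t Ht i)) as [Ku Kv].
    exact (is_derive_unique _ _ _ Kv). }
  assert (Huu : forall t, V t -> Du (Du x) t = Re_vec (phi' t) /\ Dv (Du x) t = fun i => - Im (phi' t i)).
  { intros t Ht.
    assert (K : forall i, Du (Du x) t i = Re (phi' t i) /\ Dv (Du x) t i = - Im (phi' t i)).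
    { intros i.
      destruct (pd_ext V (fun z => Du x z i) (fun z => Re (phi z i)) HV) with (z := t) as [E1 E2];
        [intros z Hz; rewrite Hu by exact Hz; reflexivity|exact Ht|].
      unfold Du at 1, Dv at 1. rewrite E1, E2.
      destruct (is_C_derive_partials_Re (fun z => phi z i) t (phi' t i) (Hphi t Ht i)) as [D1 D2].
      exact (conj (is_derive_unique _ _ _ D1) (is_derive_unique _ _ _ D2)). }
    split; apply functional_extensionality; intros i; [exact (proj1 (K i))|exact (proj2 (K i))]. }
  assert (Hvv : forall t, V t -> Dv (Dv x) t = fun i => - Re (phi' t i)).
  { intros t Ht. apply functional_extensionality. intros i.
    destruct (pd_ext V (fun z => Dv x z i) (fun z => Re (Ci * phi z i)%C) HV) with (z := t) as [_ E].
    - intros z Hz. rewrite Hv by exact Hz. destruct (phi z i); simpl; ring.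
    - exact Ht.
    - unfold Dv at 1. rewrite E.
      destruct (is_C_derive_partials_Re _ t _ (is_C_derive_scal Ci _ t (phi' t i) (Hphi t Ht i))) as [_ D2].
      transitivity (- Im (Ci * phi' t i)%C); [exact (is_derive_unique _ _ _ D2)|].
      destruct (phi' t i); simpl; ring. }
  assert (HPhi : forall t, V t -> forall i, Phi x t i = phi t i).
  { intros t Ht i. unfold Phi. rewrite Hu, Hv by exact Ht. unfold Re_vec.
    destruct (phi t i). apply injective_projections; simpl; ring. }
  split; [|exact HPhi].
  assert (Hsm : smooth V x).
  { intros i n. apply (Ck_Re_holomorphic V n (fun z => Psi z i) HV).
    apply (holomorphic_intro V _ (fun z => phi z i)). intros z Hz. apply HPsi, Hz. }
  assert (Hfund : forall t, V t -> gE x t = gG x t /\ gF x t = 0 /\ 0 < gE x t).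
  { intros t Ht. destruct (Hcan t Ht) as (H0 & _ & _). specialize (Hpos t Ht).
    destruct (complex_vec_cdot (phi t) (Du x t) (Dv x t)) as [C1 C2].
    { intros i. rewrite <- HPhi by exact Ht. reflexivity. }
    rewrite C1 in H0. rewrite C2 in Hpos. simpl in Hpos.
    injection H0 as E1 E2. unfold gE, gF, gG. lra. }
  assert (Hiso : isothermal V x).
  { intros t Ht. destruct (Hfund t Ht) as (H1 & H2 & _). split; assumption. }
  assert (Hcft : canonical_first_type V x).
  { split; [exact Hiso|]. intros t Ht. simpl.
    destruct (Hfund t Ht) as (_ & _ & HE). destruct (Huu t Ht) as [E1 E2].
    destruct (Hcan t Ht) as (_ & H1 & _).
    destruct (complex_vec_cdot (phi' t) (Du (Du x) t) (Dv (Du x) t)) as [C1 _].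
    { intros i. rewrite E1, E2. unfold Re_vec.
      destruct (phi' t i). apply injective_projections; simpl; ring. }
    rewrite C1 in H1. injection H1 as K1 K2.
    pose proof (canonical_isothermal V x HV Hsm Hiso t Ht HE) as [F1 F2]. simpl in F1, F2.
    rewrite F1, F2, K1. replace (dot (Du (Du x) t) (Dv (Du x) t)) with 0 by lra.
    split; field; lra. }
  split; [split; [exact Hsm|]|split; [|split; [apply canonical_not_degenerate, Hcft|exact Hcft]]].
  - intros t Ht [X1 X2] HX. rewrite dot_tangent. simpl.
    destruct (Hfund t Ht) as (HG & HF & HE). rewrite HF, <- HG.
    assert (X1 <> 0 \/ X2 <> 0).
    { destruct (Req_dec X1 0) as [->|]; [|auto]. destruct (Req_dec X2 0) as [->|]; [|auto].
      exfalso. apply HX. reflexivity. }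
    assert (0 < X1 * X1 + X2 * X2).
    { pose proof (Rle_0_sqr X1). pose proof (Rle_0_sqr X2). unfold Rsqr in *.
      destruct H as [H|H]; pose proof (Rsqr_pos_lt _ H); unfold Rsqr in *; lra. }
    nra.
  - intros t Ht i. destruct (Hfund t Ht) as (_ & _ & HE).
    rewrite (mean_curvature_isothermal V) by (assumption || lra).
    rewrite (proj1 (Huu t Ht)), Hvv by exact Ht. unfold Re_vec. ring.
Qed.

(** * The Weierstrass representation *)

Lemma null_coordinates_weierstrass (g1 g2 s : C -> C) (t : C) :
  s t <> RtoC 0 ->
  coord_a (weierstrass_Phi g1 g2 s t) = (- / s t)%C /\
  coord_b (weierstrass_Phi g1 g2 s t) = (g1 t * g2 t * / s t)%C /\
  coord_c (weierstrass_Phi g1 g2 s t) = (g1 t * / s t)%C /\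
  coord_d (weierstrass_Phi g1 g2 s t) = (g2 t * / s t)%C.
Proof.
  intros Hs. unfold coord_a, coord_b, coord_c, coord_d, weierstrass_Phi. split; [|split; [|split]].
  - replace (Ci * (Ci / 2 * ((g1 t * g2 t + 1) / s t)))%C with
      ((Ci * Ci) / 2 * ((g1 t * g2 t + 1) / s t))%C by (field; exact Hs).
    rewrite Ci_sqr. field. exact Hs.
  - replace (Ci * (Ci / 2 * ((g1 t * g2 t + 1) / s t)))%C with
      ((Ci * Ci) / 2 * ((g1 t * g2 t + 1) / s t))%C by (field; exact Hs).
    rewrite Ci_sqr. field. exact Hs.
  - field. exact Hs.
  - field. exact Hs.
Qed.

Lemma holomorphic_weierstrass_Phi (U : C -> Prop) (g1 g2 s : C -> C) :
  holomorphic U g1 -> holomorphic U g2 -> holomorphic U s ->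
  (forall t, U t -> s t <> RtoC 0) ->
  forall i, holomorphic U (fun z => weierstrass_Phi g1 g2 s z i).
Proof.
  intros H1 H2 Hs Hs0 i t Ht.
  pose proof (holomorphic_is_derive U g1 t H1 Ht) as D1.
  pose proof (holomorphic_is_derive U g2 t H2 Ht) as D2.
  pose proof (is_C_derive_inv s t _ (holomorphic_is_derive U s t Hs Ht) (Hs0 t Ht)) as Di.
  assert (K : forall (k : C) (h : C -> C) (h' : C), is_C_derive h t h' ->
    ex_derive (K := C_AbsRing) (V := C_NormedModule) (fun z => (k * (h z / s z))%C) t).
  { intros k h h' Hh. eexists. apply is_C_derive_scal.
    apply (is_C_derive_mult h (fun z => / s z)%C); [exact Hh|exact Di]. }
  destruct i; simpl.
  - apply (K _ (fun z => g1 z * g2 z + 1)%C (C_derive g1 t * g2 t + g1 t * C_derive g2 t + 0)%C).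
    apply is_C_derive_plus; [apply is_C_derive_mult; assumption|apply is_C_derive_const].
  - apply (K _ (fun z => g1 z * g2 z - 1)%C (C_derive g1 t * g2 t + g1 t * C_derive g2 t - 0)%C).
    apply is_C_derive_minus; [apply is_C_derive_mult; assumption|apply is_C_derive_const].
  - apply (K _ (fun z => g1 z + g2 z)%C (C_derive g1 t + C_derive g2 t)%C).
    apply is_C_derive_plus; assumption.
  - apply (K _ (fun z => g1 z - g2 z)%C (C_derive g1 t - C_derive g2 t)%C).
    apply is_C_derive_minus; assumption.
Qed.

Lemma sqrt_branch_nonzero (D U : C -> Prop) (g1 g2 s : C -> C) :
  weierstrass_pair D g1 g2 -> subdomain U D -> g_sqrt_branch U g1 g2 s ->
  forall t, U t -> s t <> RtoC 0.
Proof.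
  intros (_ & _ & H) HUD (_ & Hs) t Ht E.
  apply (proj1 (H t (HUD t Ht))). rewrite <- Hs, E by exact Ht. ring.
Qed.

(** By the Weierstrass formulas twice the hermitian square is
    [(1 + |g1 g2|^2 + 2 Re (g1 (conj g2))) / |s|^2], and the numerator is [|1 + g1 (conj g2)|^2]. *)
Lemma weierstrass_hermitian (g1 g2 s : C -> C) (t : C) :
  s t <> RtoC 0 ->
  (hermitian (weierstrass_Phi g1 g2 s t) + hermitian (weierstrass_Phi g1 g2 s t))%C =
  RtoC (Cmod (/ s t * (1 + g1 t * Cconj (g2 t))) ^ 2).
Proof.
  intros Hs. destruct (null_coordinates_weierstrass g1 g2 s t Hs) as (Ea & Eb & Ec & Ed).
  rewrite null_coordinates_hermitian, Ea, Eb, Ec, Ed, Cmod2_conj.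
  rewrite ?Cmult_conj, ?Cplus_conj, ?Cmult_conj, ?Copp_conj, ?Cconj_conj.
  replace (Cconj 1) with (RtoC 1) by (apply injective_projections; simpl; ring).
  ring.
Qed.

(** With [w = 1 / s] the null coordinates are [- w], [g1 g2 w], [g1 w] and [g2 w]; in
    [a' b' + c' d'] all terms with [w'] cancel and [g1' g2' w^2 = 1] remains. *)
Theorem weierstrass_canonical_curve (D U : C -> Prop) (g1 g2 s : C -> C) :
  weierstrass_pair D g1 g2 -> open U -> subdomain U D -> g_sqrt_branch U g1 g2 s ->
  canonical_curve U (weierstrass_Phi g1 g2 s)
    (fun t i => C_derive (fun z => weierstrass_Phi g1 g2 s z i) t) /\
  forall t, U t -> 0 < Re (hermitian (weierstrass_Phi g1 g2 s t)).
Proof.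
  intros HW HU HUD Hbr.
  pose proof (sqrt_branch_nonzero D U g1 g2 s HW HUD Hbr) as Hs0.
  destruct HW as (Hg1 & Hg2 & Hne). destruct Hbr as (Hs & Hss).
  assert (Hg1U : holomorphic U g1) by (intros t Ht; apply Hg1, HUD, Ht).
  assert (Hg2U : holomorphic U g2) by (intros t Ht; apply Hg2, HUD, Ht).
  set (phi := weierstrass_Phi g1 g2 s).
  set (phi' := fun (t : C) (i : axis) => C_derive (fun z => phi z i) t).
  assert (Hphi : holomorphic_curve U phi phi').
  { intros t Ht i. apply (holomorphic_is_derive U (fun z => phi z i)); [|exact Ht].
    apply holomorphic_weierstrass_Phi; assumption. }
  assert (Hpos : forall t, U t -> 0 < Re (hermitian (phi t))).
  { intros t Ht. pose proof (weierstrass_hermitian g1 g2 s t (Hs0 t Ht)) as H. fold phi in H.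
    assert (Hc : 0 < Cmod (/ s t * (1 + g1 t * Cconj (g2 t))) ^ 2).
    { apply pow_lt, Cmod_gt_0, Cmult_neq_0.
      - intros E. apply C1_nz. rewrite <- (Cinv_r (s t)) by (apply Hs0, Ht). rewrite E. ring.
      - intros E. apply (proj2 (Hne t (HUD t Ht))).
        replace (g1 t * Cconj (g2 t))%C with (1 + g1 t * Cconj (g2 t) - 1)%C by ring.
        rewrite E. apply injective_projections; simpl; ring. }
    revert H Hc. generalize (hermitian (phi t)) as h.
    generalize (Cmod (/ s t * (1 + g1 t * Cconj (g2 t))) ^ 2) as m.
    intros m h E Hm. apply (f_equal fst) in E. simpl in E. unfold Re. lra. }
  split; [|exact Hpos]. split; [exact Hphi|]. intros t Ht. split; [|split].
  - destruct (null_coordinates_weierstrass g1 g2 s t (Hs0 t Ht)) as (Ea & Eb & Ec & Ed).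
    rewrite null_coordinates_sqr. unfold phi. rewrite Ea, Eb, Ec, Ed. ring.
  - destruct (is_C_derive_null_coordinates phi t (phi' t) (Hphi t Ht)) as (Da & Db & Dc & Dd).
    pose proof (holomorphic_is_derive U g1 t Hg1U Ht) as D1.
    pose proof (holomorphic_is_derive U g2 t Hg2U Ht) as D2.
    pose proof (is_C_derive_inv s t _ (holomorphic_is_derive U s t Hs Ht) (Hs0 t Ht)) as Dw.
    set (w' := (C_derive s t * - / (s t * s t))%C) in Dw.
    assert (T : forall (f h : C -> C) (l l' : C), is_C_derive f t l ->
      (forall z, U z -> f z = h z) -> is_C_derive h t l' -> l = l').
    { intros f h l l' Hf E Hh. apply (is_C_derive_inj f t _ _ Hf).
      apply (is_C_derive_ext_loc h); [|exact Hh].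
      generalize (open_locally_2d U t HU Ht). apply locally_2d_impl, locally_2d_forall.
      intros u v Huv. symmetry. apply E, Huv. }
    assert (N : forall z, U z -> _) by exact (fun z Hz => null_coordinates_weierstrass g1 g2 s z (Hs0 z Hz)).
    assert (Fa : coord_a (phi' t) = (- w')%C).
    { apply (T _ (fun z => - / s z)%C _ _ Da); [intros z Hz; exact (proj1 (N z Hz))|].
      apply (is_C_derive_opp (fun z => / s z)%C), Dw. }
    assert (Fb : coord_b (phi' t) = ((C_derive g1 t * g2 t + g1 t * C_derive g2 t) * / s t + g1 t * g2 t * w')%C).
    { apply (T _ (fun z => g1 z * g2 z * / s z)%C _ _ Db);
        [intros z Hz; exact (proj1 (proj2 (N z Hz)))|].
      apply (is_C_derive_mult (fun z => g1 z * g2 z)%C (fun z => / s z)%C);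
        [apply is_C_derive_mult; assumption|exact Dw]. }
    assert (Fc : coord_c (phi' t) = (C_derive g1 t * / s t + g1 t * w')%C).
    { apply (T _ (fun z => g1 z * / s z)%C _ _ Dc);
        [intros z Hz; exact (proj1 (proj2 (proj2 (N z Hz))))|].
      apply (is_C_derive_mult g1 (fun z => / s z)%C); [exact D1|exact Dw]. }
    assert (Fd : coord_d (phi' t) = (C_derive g2 t * / s t + g2 t * w')%C).
    { apply (T _ (fun z => g2 z * / s z)%C _ _ Dd);
        [intros z Hz; exact (proj2 (proj2 (proj2 (N z Hz))))|].
      apply (is_C_derive_mult g2 (fun z => / s z)%C); [exact D2|exact Dw]. }
    rewrite null_coordinates_sqr, Fa, Fb, Fc, Fd.
    replace (- w' * ((C_derive g1 t * g2 t + g1 t * C_derive g2 t) * / s t + g1 t * g2 t * w') +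
      (C_derive g1 t * / s t + g1 t * w') * (C_derive g2 t * / s t + g2 t * w'))%C with
      ((C_derive g1 t * C_derive g2 t) * (/ s t * / s t))%C by ring.
    rewrite <- Hss by exact Ht. field. apply Hs0, Ht.
  - intros E. specialize (Hpos t Ht). rewrite E in Hpos. simpl in Hpos. lra.
Qed.

Lemma locally'_of_locally_2d (P : C -> Prop) (t : C) :
  locally_2d (fun u v => (u, v) <> t -> P (u, v)) (fst t) (snd t) -> locally' t P.
Proof.
  intros H. apply locally_C. apply locally_C_2d. exact H.
Qed.

Theorem theorem9p3 :
  (forall (D : C -> Prop) (x : C -> vec R),
     complex_domain D ->
     minimal_spacelike_general_canonical D x ->
     (* the representation itself, off a set of isolated points *)
     has_weierstrass_representation (finite_part D x) x /\
     (forall t0 : C, D t0 -> locally' t0 (finite_part D x)) /\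
     (* around each of these points, the representation after a motion *)
     (forall t0 : C, D t0 -> ~ finite_part D x t0 ->
        exists U : C -> Prop,
          complex_domain U /\ U t0 /\ subdomain U D /\
          has_weierstrass_representation U (fun t => half_turn (x t))))
  /\
  (forall (D : C -> Prop) (g1 g2 : C -> C),
     complex_domain D ->
     weierstrass_pair D g1 g2 ->
     (* local branches of sqrt (g1' g2') exist *)
     (forall t0 : C, D t0 ->
        exists (U : C -> Prop) (s : C -> C),
          complex_domain U /\ U t0 /\ subdomain U D /\ g_sqrt_branch U g1 g2 s) /\
     (* and for every branch Phi generates a surface as claimed *)
     (forall (U : C -> Prop) (s : C -> C),
        open U -> subdomain U D -> g_sqrt_branch U g1 g2 s ->
        (forall t0 : C, U t0 ->
           exists (V : C -> Prop) (Psi : C -> vec C),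
             complex_domain V /\ V t0 /\ subdomain V U /\
             holo_primitive V Psi (weierstrass_Phi g1 g2 s)) /\
        (forall (V : C -> Prop) (Psi : C -> vec C),
           open V -> subdomain V U ->
           holo_primitive V Psi (weierstrass_Phi g1 g2 s) ->
           minimal_spacelike_general_canonical V (real_part Psi) /\
           forall t, V t -> forall i,
             Phi (real_part Psi) t i = weierstrass_Phi g1 g2 s t i))).
Proof.
  assert (Hsub : forall (U V : C -> Prop) phi phi',
    subdomain V U -> canonical_curve U phi phi' -> canonical_curve V phi phi').
  { intros U V phi phi' HVU [H1 H2]. split; intros t Ht; [apply H1|apply H2]; apply HVU, Ht. }
  split.
  - intros D x [HD _] Hx.
    pose proof (surface_canonical_curve D x HD Hx) as Hc.
    split; [|split].
    + assert (Hopen : open (finite_part D x)).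
      { apply open_of_locally_2d. intros t [Ht Ha].
        destruct (is_C_derive_null_coordinates (Phi x) t _ (proj1 Hc t Ht)) as (Da & _).
        apply (locally_2d_and (fun u v => D (u, v))).
        - apply open_locally_2d; assumption.
        - apply (is_C_derive_nonzero (fun z => coord_a (Phi x z)) t _ Da Ha). }
      apply (canonical_curve_weierstrass _ (Phi x) (Phi_derivative x) Hopen).
      * apply (Hsub D); [|exact Hc]. intros t [Ht _]. exact Ht.
      * intros t [_ Ha]. exact Ha.
    + intros t Ht. apply locally'_of_locally_2d.
      generalize (locally_2d_and _ _ _ _ (open_locally_2d D t HD Ht)
        (canonical_curve_coord_a_isolated D _ _ t HD Hc Ht)).
      apply locally_2d_impl, locally_2d_forall. intros u v [Huv Ha] Hne.
      split; [exact Huv|exact (Ha Hne)].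
    + intros t Ht Hnf.
      assert (Ha : coord_a (Phi x t) = RtoC 0).
      { apply NNPP. intros Ha. apply Hnf. split; assumption. }
      destruct (canonical_curve_coord_a_zero D _ _ t HD Hc Ht Ha) as (Hb & _).
      destruct (is_C_derive_null_coordinates (Phi x) t _ (proj1 Hc t Ht)) as (_ & Db & _).
      destruct (locally_2d_square (fun z => D z /\ coord_b (Phi x z) <> RtoC 0) t) as (r & Hr & HS).
      { apply (locally_2d_and (fun u v => D (u, v))).
        - apply open_locally_2d; assumption.
        - apply (is_C_derive_nonzero (fun z => coord_b (Phi x z)) t _ Db Hb). }
      exists (square t r). split; [apply square_domain, Hr|].
      split; [apply square_center, Hr|].
      split; [intros z Hz; apply HS, Hz|].
      destruct (canonical_curve_weierstrass (square t r) (fun z => half_turn_C (Phi x z))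
        (fun z => half_turn_C (Phi_derivative x z))) as (g1 & g2 & s & H1 & H2 & H3).
      * apply square_open.
      * apply canonical_curve_half_turn. apply (Hsub D); [|exact Hc]. intros z Hz. apply HS, Hz.
      * intros z Hz. rewrite coord_a_half_turn. apply HS, Hz.
      * exists g1, g2, s. split; [exact H1|]. split; [exact H2|].
        intros z Hz i. rewrite Phi_half_turn. apply H3, Hz.
  - intros D g1 g2 [HD _] HW. split.
    + intros t Ht. destruct HW as (Hg1 & Hg2 & Hne).
      destruct (local_sqrt_branch D (fun z => C_derive g1 z * C_derive g2 z)%C t HD) as (r & s & Hr & HrD & Hs).
      * intros z Hz. eexists.
        apply is_C_derive_mult; apply (holomorphic_is_derive D); try exact Hz;
          apply holomorphic_derive; assumption.
      * exact Ht.
      * apply Hne, Ht.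
      * exists (square t r), s. split; [apply square_domain, Hr|].
        split; [apply square_center, Hr|]. split; assumption.
    + intros U s HU HUD Hs.
      destruct (weierstrass_canonical_curve D U g1 g2 s HW HU HUD Hs) as [Hc Hpos].
      split.
      * intros t Ht. destruct (open_square_inside U t HU Ht) as (r & Hr & HrU).
        assert (HP : forall i, exists F, forall z, square t r z ->
          is_C_derive F z (weierstrass_Phi g1 g2 s z i)).
        { intros i. apply holomorphic_local_primitive.
          intros z Hz. eexists. apply (proj1 Hc z (HrU z Hz) i). }
        destruct (HP e1) as [F1 HF1]. destruct (HP e2) as [F2 HF2].
        destruct (HP e3) as [F3 HF3]. destruct (HP e4) as [F4 HF4].
        exists (square t r),
          (fun z i => match i with e1 => F1 z | e2 => F2 z | e3 => F3 z | e4 => F4 z end).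
        split; [apply square_domain, Hr|]. split; [apply square_center, Hr|].
        split; [exact HrU|].
        intros z Hz i. destruct i; [apply HF1|apply HF2|apply HF3|apply HF4]; exact Hz.
      * intros V Psi HV HVU HPsi.
        apply (curve_surface V Psi (weierstrass_Phi g1 g2 s)
          (fun t i => C_derive (fun z => weierstrass_Phi g1 g2 s z i) t) HV).
        -- apply (Hsub U); assumption.
        -- intros t Ht. apply Hpos, HVU, Ht.
        -- exact HPsi.
Qed.
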